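(* Let $X$ be an irreducible affine variety over an algebraically closed field $\Bbbk$ of characteristic zero. The following are equivalent: (1) $X$ possesses a flexible point; (2) the group $\mathrm{SAut}(X)$ acts on $X$ with an open orbit; (3) the field Makar-Limanov invariant $\mathrm{FML}(X)$ is trivial. In the latter case $X$ is unirational.
   Context: $X_{\mathrm{reg}}$ is the smooth locus of $X$. A one-parameter unipotent subgroup of $\mathrm{Aut}(X)$ is a subgroup $H\cong\mathbb{G}_a$ such that $H\times X\to X$ is a morphism; $\mathrm{SAut}(X)$ is the subgroup of $\mathrm{Aut}(X)$ generated by all of these. A point $x\in X_{\mathrm{reg}}$ is flexible if $T_xX$ is spanned by the tangent vectors at $x$ to orbits $H.x$ of one-parameter unipotent subgroups $H\subseteq\mathrm{Aut}(X)$. The field Makar-Limanov invariant $\mathrm{FML}(X)$ is the subfield of the field of rational functions on $X$ consisting of all rational $\mathrm{SAut}(X)$-invariants; it is trivial if $\mathrm{FML}(X)=\Bbbk$. *)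

(* Defs.v *)
From HB Require Import structures.
From mathcomp Require Import all_boot all_order all_algebra all_classical.
From mathcomp Require Import mpoly.

Set Implicit Arguments.
Unset Strict Implicit.
Unset Printing Implicit Defensive.

Import GRing.Theory.

Local Open Scope classical_set_scope.
Local Open Scope ring_scope.

Local Notation "x %:F" := (@FracField.tofrac _ x).

Lemma repr_numden (R : idomainType) (f : {fraction R}) :
  f = (\n_(repr f))%:F / (\d_(repr f))%:F.
Proof.
have d0 : (\d_(repr f))%:F != 0 by rewrite tofrac_eq0 denom_ratioP.
apply: (canRL (mulfK d0)); rewrite -[X in X * _]reprK.
unlock FracField.tofrac; rewrite -[LHS]FracField.pi_mul /FracField.mulf.
apply/eqmodP; rewrite /= FracField.equivfE.
by rewrite !numden_Ratio ?mulf_neq0 ?oner_neq0 ?denom_ratioP // !mulr1 mulrC.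
Qed.

(* Affine n-space over k is the set of row vectors 'rV[k]_n; as k is
   algebraically closed, a variety is identified with its set of k-points. *)

Section Zariski.
Variables (k : closedFieldType) (n : nat).
Implicit Types V W : set 'rV[k]_n.

Definition zero_locus (S : set {mpoly k[n]}) : set 'rV[k]_n :=
  [set x : 'rV[k]_n | forall p, S p -> p.@[x 0] = 0].

Definition vanishing_ideal V : set {mpoly k[n]} :=
  [set p : {mpoly k[n]} | forall x : 'rV[k]_n, V x -> p.@[x 0] = 0].

Definition zariski_closed V := exists S, V = zero_locus S.

Definition zariski_closure V := zero_locus (vanishing_ideal V).

Definition zariski_irreducible V :=
  V !=set0 /\
  forall V1 V2, zariski_closed V1 -> zariski_closed V2 ->
    V `<=` V1 `|` V2 -> V `<=` V1 \/ V `<=` V2.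

(* The common kernel of the differentials at x of the polynomials vanishing
   on V.  For V locally closed and x in V this is the tangent space of V at x,
   since V and its closure have the same vanishing ideal. *)
Definition tangent_space V (x : 'rV[k]_n) : set 'rV[k]_n :=
  [set v : 'rV[k]_n | forall p, vanishing_ideal V p ->
             \sum_(i < n) (p^`M(i)).@[x 0] * v 0 i = 0].

Definition linear_span (S : set 'rV[k]_n) : set 'rV[k]_n :=
  [set v : 'rV[k]_n | exists2 s : seq 'rV[k]_n,
             (forall w, w \in s -> S w) & v \in <<s>>%VS].

Definition has_dim (T : set 'rV[k]_n) (d : nat) :=
  exists U : {vspace 'rV[k]_n}, T = [set v : 'rV[k]_n | v \in U] /\ \dim U = d.

End Zariski.

(* An irreducible affine variety, given as a closed subset of n-space.  Through
   the coercion of sets to types, [x : X] denotes a point of X. *)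
Record irr_affine_variety (k : closedFieldType) (n : nat) := IrrAffineVariety {
  carrier :> set 'rV[k]_n;
  carrier_closed : zariski_closed carrier;
  carrier_irreducible : zariski_irreducible carrier }.

Section RegularFunctions.
Variables (k : closedFieldType) (n : nat) (X : irr_affine_variety k n).

Definition zariski_open (U : set X) :=
  exists2 Z : set 'rV[k]_n, zariski_closed Z & U = [set x : X | ~ Z (val x)].

Definition is_regular (f : X -> k) :=
  exists p : {mpoly k[n]}, forall x : X, f x = p.@[val x 0].

Definition is_regular_map (f : X -> X) :=
  exists P : 'I_n -> {mpoly k[n]},
    forall (x : X) i, val (f x) 0 i = (P i).@[val x 0].

Definition regular_pred : pred (X -> k) := fun f => `[< is_regular f >].

Lemma regular_subring : subring_closed regular_pred.
Proof.
split.
- by apply/asboolP; exists 1 => x; rewrite meval1.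
- move=> f g /asboolP[p fp] /asboolP[q gq]; apply/asboolP; exists (p - q) => x.
  by rewrite mevalB -fp -gq.
- move=> f g /asboolP[p fp] /asboolP[q gq]; apply/asboolP; exists (p * q) => x.
  by rewrite mevalM -fp -gq.
Qed.

Record regular_function := RegularFunction {
  regular_fun :> X -> k;
  regular_funP : regular_fun \in regular_pred }.

HB.instance Definition _ := [isSub for regular_fun].
HB.instance Definition _ := [Choice of regular_function by <:].
HB.instance Definition _ :=
  GRing.SubChoice_isSubComPzRing.Build (X -> k) regular_pred regular_function
    regular_subring.

Lemma regular_function_is_regular (f : regular_function) : is_regular f.
Proof. by apply/asboolP; exact: (regular_funP f). Qed.

Definition Regular (f : X -> k) (fr : is_regular f) : regular_function :=
  RegularFunction (asboolT fr).

Lemma regular_function_ext (f g : regular_function) :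
  (forall x, f x = g x) -> f = g.
Proof. by move=> fg; apply/val_inj/funext. Qed.

Lemma regular_oner_neq0 : (1 : regular_function) != 0.
Proof.
have [[x Xx] _] := carrier_irreducible X.
apply/eqP => /(congr1 (fun f : regular_function => f (SigSub (mem_set Xx)))).
by move/eqP; rewrite (oner_eq0 k).
Qed.
HB.instance Definition _ :=
  GRing.PzSemiRing_isNonZero.Build regular_function regular_oner_neq0.

Definition regular_unit : pred regular_function :=
  fun f => `[< exists g : regular_function, g * f = 1 >].

Definition regular_inv (f : regular_function) : regular_function :=
  if pselect (exists g : regular_function, g * f = 1) is left e
  then projT1 (cid e) else f.

Lemma regular_mulVr : {in regular_unit, left_inverse 1 regular_inv *%R}.
Proof.
move=> f /asboolP fu; rewrite /regular_inv.
by case: pselect => // e; case: cid.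
Qed.

Lemma regular_unitP (f g : regular_function) : g * f = 1 -> regular_unit f.
Proof. by move=> gf; apply/asboolP; exists g. Qed.

Lemma regular_inv_out : {in [predC regular_unit], regular_inv =1 id}.
Proof.
move=> f /asboolP fu; rewrite /regular_inv.
by case: pselect.
Qed.
HB.instance Definition _ := GRing.ComNzRing_hasMulInverse.Build regular_function
  regular_mulVr regular_unitP regular_inv_out.

Lemma regular_integral : GRing.integral_domain_axiom regular_function.
Proof.
move=> f g fg0; have [_ irr] := carrier_irreducible X.
have [p fp] := regular_function_is_regular f.
have [q gq] := regular_function_is_regular g.
have zero1 (r : {mpoly k[n]}) (x : 'rV[k]_n) :
    zero_locus [set r] x <-> r.@[x 0] = 0.
  by split=> [/(_ r erefl)//|r0 _ ->].
have [||x Xx|Xp|Xq] := irr (zero_locus [set p]) (zero_locus [set q]).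
- by exists [set p].
- by exists [set q].
- have := congr1 (fun f : regular_function => f (SigSub (mem_set Xx))) fg0.
  move=> /= /eqP.
  rewrite [X in X == _](_ : _ = p.@[x 0] * q.@[x 0]); last first.
    by rewrite -[RHS]/(p.@[val (SigSub (mem_set Xx)) 0] *
                       q.@[val (SigSub (mem_set Xx)) 0]) -fp -gq.
  by rewrite (mulf_eq0 p.@[x 0]) => /orP[]/eqP ?; [left|right]; apply/zero1.
- apply/orP; left; apply/eqP/regular_function_ext => x.
  by rewrite fp; apply/zero1/Xp/set_mem/valP.
- apply/orP; right; apply/eqP/regular_function_ext => x.
  by rewrite gq; apply/zero1/Xq/set_mem/valP.
Qed.
HB.instance Definition _ :=
  GRing.ComUnitRing_isIntegral.Build regular_function regular_integral.

Lemma const_is_regular (c : k) : is_regular (fun=> c).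
Proof. by exists c%:MP => x; rewrite mevalC. Qed.

Definition const_rational (c : k) : {fraction regular_function} :=
  (Regular (const_is_regular c))%:F.

Definition algebraically_independent d
    (s : 'I_d -> {fraction regular_function}) :=
  forall P : {mpoly k[d]}, mmap const_rational s P = 0 -> P = 0.

(* The dimension is the transcendence degree of the function field over k. *)
Definition variety_dim (d : nat) :=
  (exists s : 'I_d -> {fraction regular_function},
     algebraically_independent s) /\
  (forall s : 'I_d.+1 -> {fraction regular_function},
     ~ algebraically_independent s).

Definition smooth_point (x : X) :=
  exists2 d, variety_dim d & has_dim (tangent_space X (val x)) d.

(* X is the closure of the image of a rational map from some affine m-space,
   written with a common denominator q, hence regular where q != 0. *)
Definition unirational :=
  exists (m : nat) (q : {mpoly k[m]}) (p : 'I_n -> {mpoly k[m]}),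
    let phi (a : 'rV[k]_m) : 'rV[k]_n := \row_i ((p i).@[a 0] / q.@[a 0]) in
    let image := phi @` [set a : 'rV[k]_m | q.@[a 0] != 0] in
    [/\ q != 0, image `<=` X & X `<=` zariski_closure image].

End RegularFunctions.

Section Automorphisms.
Variables (k : closedFieldType) (n : nat) (X : irr_affine_variety k n).

Record automorphism := Automorphism {
  aut_fun :> X -> X;
  aut_inv : X -> X;
  aut_funK : cancel aut_fun aut_inv;
  aut_invK : cancel aut_inv aut_fun;
  aut_fun_regular : is_regular_map aut_fun;
  aut_inv_regular : is_regular_map aut_inv }.

HB.instance Definition _ := gen_eqMixin automorphism.
HB.instance Definition _ := gen_choiceMixin automorphism.

Lemma automorphism_ext (g h : automorphism) : (forall x, g x = h x) -> g = h.
Proof.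
case: g h => [g g' gK g'K gr g'r] [h h' hK h'K hr h'r] /= /funext gh.
move: gK g'K gr; rewrite {}gh => gK g'K gr.
have e : g' = h' by apply/funext => x; rewrite -{1}(h'K x) gK.
by move: gK g'K g'r; rewrite {}e => *; congr Automorphism; exact: Prop_irrelevance.
Qed.

Lemma id_is_regular_map : is_regular_map (@id X).
Proof. by exists (fun i => 'X_i) => x i; rewrite mevalXU. Qed.

Lemma comp_mpoly_regular (f : X -> X) (p : {mpoly k[n]}) :
  is_regular_map f ->
  exists q : {mpoly k[n]}, forall x : X, p.@[val (f x) 0] = q.@[val x 0].
Proof.
move=> [P fP]; exists (p \mPo [tuple P i | i < n]) => x.
rewrite comp_mpoly_meval; apply: meval_eq => i.
by rewrite tnth_mktuple.
Qed.

Lemma comp_is_regular_map (f g : X -> X) :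
  is_regular_map f -> is_regular_map g -> is_regular_map (f \o g).
Proof.
move=> [P fP] gr.
have /choice[Q PQ] i := comp_mpoly_regular (P i) gr.
by exists Q => x i; rewrite /= fP PQ.
Qed.

Definition aut_one : automorphism :=
  @Automorphism id id (fun=> erefl) (fun=> erefl)
    id_is_regular_map id_is_regular_map.

Definition aut_mul (g h : automorphism) : automorphism :=
  @Automorphism (g \o h) (aut_inv h \o aut_inv g)
    (can_comp (aut_funK g) (aut_funK h)) (can_comp (aut_invK h) (aut_invK g))
    (comp_is_regular_map (aut_fun_regular g) (aut_fun_regular h))
    (comp_is_regular_map (aut_inv_regular h) (aut_inv_regular g)).

Definition aut_invg (g : automorphism) : automorphism :=
  Automorphism (aut_invK g) (aut_funK g)
    (aut_inv_regular g) (aut_fun_regular g).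

Lemma aut_mulA : associative aut_mul.
Proof. by move=> f g h; apply: automorphism_ext. Qed.
Lemma aut_mul1 : left_id aut_one aut_mul.
Proof. by move=> g; apply: automorphism_ext. Qed.
Lemma aut_1mul : right_id aut_one aut_mul.
Proof. by move=> g; apply: automorphism_ext. Qed.
Lemma aut_mulVg : left_inverse aut_one aut_invg aut_mul.
Proof. by move=> g; apply: automorphism_ext => x /=; rewrite aut_funK. Qed.
Lemma aut_mulgV : right_inverse aut_one aut_invg aut_mul.
Proof. by move=> g; apply: automorphism_ext => x /=; rewrite aut_invK. Qed.
HB.instance Definition _ := isGroup.Build automorphism
  aut_mulA aut_mul1 aut_1mul aut_mulVg aut_mulgV.

Definition is_subgroup (H : set automorphism) :=
  H 1%g /\ forall g h, H g -> H h -> H (g^-1 * h)%g.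

Definition generated_subgroup (S : set automorphism) : set automorphism :=
  [set g | forall H, is_subgroup H -> S `<=` H -> H g].

(* The action of phi is a morphism from A^1 x X, a closed subset of affine
   (1 + n)-space, to X. *)
Definition algebraic_action (phi : k -> automorphism) :=
  exists P : 'I_n -> {mpoly k[1 + n]},
    forall (t : k) (x : X) i,
      val (phi t x) 0 i = (P i).@[row_mx (t%:M : 'rV[k]_1) (val x) 0].

Definition one_param_unipotent (H : set automorphism) :=
  exists phi : k -> automorphism,
    [/\ injective phi, {morph phi : s t / s + t >-> (s * t)%g},
        algebraic_action phi & H = range phi].

Definition SAut : set automorphism :=
  generated_subgroup (\bigcup_(H in one_param_unipotent) H).

Definition orbit_of (H : set automorphism) (x : X) : set X :=
  [set g x | g in H].

Definition flexible_point (x : X) :=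
  smooth_point x /\
  tangent_space X (val x) =
    linear_span (\bigcup_(H in one_param_unipotent)
                   tangent_space (val @` orbit_of H x) (val x)).

Lemma comp_aut_is_regular (g : automorphism) (f : regular_function X) :
  is_regular (f \o g).
Proof.
have [p fp] := regular_function_is_regular f.
have [q pq] := comp_mpoly_regular p (aut_fun_regular g).
by exists q => x; rewrite /= fp pq.
Qed.

Definition pullback (g : automorphism) (f : regular_function X) :=
  Regular (comp_aut_is_regular g f).

Definition rational_pullback (g : automorphism)
    (f : {fraction regular_function X}) : {fraction regular_function X} :=
  (pullback g \n_(repr f))%:F / (pullback g \d_(repr f))%:F.

Lemma pullbackM g : {morph pullback g : a b / a * b}.
Proof. by move=> a b; apply: regular_function_ext. Qed.

Lemma pullback_neq0 g (b : regular_function X) : b != 0 -> pullback g b != 0.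
Proof.
apply: contra_neq => gb0; apply: regular_function_ext => x.
rewrite -(aut_invK g x).
exact: (congr1 (fun f : regular_function X => f (aut_inv g x)) gb0).
Qed.

(* The action does not depend on the chosen representative of a fraction. *)
Lemma rational_pullbackE g (a b : regular_function X) : b != 0 ->
  rational_pullback g (a%:F / b%:F) = (pullback g a)%:F / (pullback g b)%:F.
Proof.
move=> b0; rewrite /rational_pullback.
have := repr_numden (a%:F / b%:F); have := denom_ratioP (repr (a%:F / b%:F)).
move: (\n_ _) (\d_ _) => c d d0 /eqP.
have tf0 (e : regular_function X) : e != 0 -> e%:F != 0 by rewrite tofrac_eq0.
have pf0 (e : regular_function X) : e != 0 -> (pullback g e)%:F != 0.
  by move=> /(pullback_neq0 g)/tf0.
rewrite (eqr_div _ _ (tf0 _ b0) (tf0 _ d0)) -!rmorphM tofrac_eq => /eqP ad.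
apply/eqP; rewrite (eqr_div _ _ (pf0 _ d0) (pf0 _ b0)).
by rewrite -!rmorphM -!pullbackM ad.
Qed.

Definition FML : set {fraction regular_function X} :=
  [set f | forall g, SAut g -> rational_pullback g f = f].

Definition FML_trivial := FML = range (@const_rational k n X).

End Automorphisms.

(* Main.v *)
From HB Require Import structures.
Require Import Defs.
From mathcomp Require Import all_boot all_order all_algebra all_classical.
From mathcomp Require Import mpoly closed_field ring.

(** A one-parameter unipotent subgroup [phi] acts on the ring k[X] of regular
    functions as t |-> exp (t D) for a locally nilpotent derivation D; the
    values of D on the coordinates form the velocity field of [phi].  The three
    conditions are compared through these derivations.

    A flexible point gives a dominant map.  The tangent line at x to a
    non-constant orbit of one subgroup is spanned by its velocity
    ([orbit_tangent_line]).  Hence at a flexible point x there are d = dim X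
    subgroups whose velocities form a basis of the tangent space, and the map
    (t_1, ..., t_d) |-> phi_1(t_1) ... phi_d(t_d) x from affine d-space has a
    differential of rank d at 0.  By the Jacobian criterion d coordinates of X
    pull back to algebraically independent polynomials; a nonzero function on X
    is algebraic over these coordinates, so it cannot vanish on the image
    ([orbit_dominant]).  A dominant map from affine space is what unirationality
    asks for, and the image of a dominant map contains a nonempty open set
    ([dominant_image_open], by quantifier elimination); the translates of this
    open set cover the orbit of x, which is therefore open.

    An open orbit kills invariants: if a/b is invariant and b does not vanish at
    the point y of the orbit, then b(y) a - a(y) b vanishes on the orbit, which
    is dense, so a/b is the constant a(y)/b(y).

    Trivial invariants give a flexible point.  Let D_1, ..., D_r be a maximal
    family of these derivations that is linearly independent over k[X].
    - Conjugating one subgroup by the elements of another and differentiating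
      shows that the fraction-field span of the derivations is closed under the
      bracket ([bracket_velocities]).  So every composite of the derivations is
      a combination of ordered monomials D^alpha ([word_of_span]), as in the
      Poincare-Birkhoff-Witt theorem.
    - If m_1, ..., m_N are linearly independent over k, then no nonzero family
      a_i satisfies sum_i a_i w(m_i) = 0 for every composite w ([wronskian]):
      in such a family of minimal support the ratios of the a_i are killed by
      all derivations, hence are invariants, hence are constants.
    - Take the N^e monomials of multidegree < N in e algebraically independent
      functions.  By local nilpotency D^alpha kills them all unless alpha lies
      in a box whose side is linear in N, which leaves O(N^r) linear equations
      on N^e unknowns.  If r < e there is a nonzero solution, against the
      previous point ([independent_leq]).
    So dim X = r.  A nonzero r x r minor of the velocity matrix selects r
    coordinates that form a separating transcendence basis; at a general point
    they cut the dimension of the tangent space down to r, while the r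
    velocities are independent there.  Such a point is flexible
    ([FML_flexible]). *)

Set Implicit Arguments.
Unset Strict Implicit.
Unset Printing Implicit Defensive.

Import GRing.Theory.

Local Open Scope ring_scope.

Local Notation "x %:F" := (@FracField.tofrac _ x).

(** * Polynomials and derivations *)

Lemma mpoly_ring_ind (k : nzRingType) m (P : {mpoly k[m]} -> Prop) :
  (forall c, P c%:MP) -> (forall i, P 'X_i) ->
  (forall p q, P p -> P q -> P (p + q)) ->
  (forall p q, P p -> P q -> P (p * q)) -> forall p, P p.
Proof.
move=> PC PX PD PM; elim/mpolyind => [|c mu p _ _ Pp].
  by rewrite -mpolyC0.
apply: (PD) => //; rewrite -mul_mpolyC; apply: (PM) => //.
rewrite mpolyXE_id; elim/big_ind: _ => [|p1 p2|i _]; first by rewrite -mpolyC1.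
  exact: PM.
elim: (mu i) => [|j IH]; first by rewrite expr0 -mpolyC1.
by rewrite exprS; apply: (PM).
Qed.

Lemma mderivXU (k : nzRingType) m (i j : 'I_m) :
  ('X_i : {mpoly k[m]})^`M(j) = (i == j)%:R.
Proof.
rewrite mderivX mnm1E; case: eqP => [->|_]; last by rewrite scale0r.
suff -> : (U_(j) - U_(j) = 0)%MM by rewrite mpolyX0 scale1r.
by apply/mnmP => l; rewrite mnmBE subnn mnm0E.
Qed.

Section Derivations.
Variables (k : nzRingType) (A B : comNzRingType).
Variables (iota : {rmorphism k -> A}) (ev : {rmorphism A -> B}).

(** Derivations with values in a module over another ring: [ev] is the identity
    for derivations of a ring and evaluation at a point for tangent vectors, so
    that one chain rule serves both. *)
Definition derivation_along (d : A -> B) :=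
  [/\ forall c, d (iota c) = 0, forall a b, d (a + b) = d a + d b
    & forall a b, d (a * b) = d a * ev b + ev a * d b].

Lemma chain_rule m (u : 'I_m -> A) (d : A -> B) (P : {mpoly k[m]}) :
  derivation_along d ->
  d (mmap iota u P) = \sum_j ev (mmap iota u P^`M(j)) * d (u j).
Proof.
case=> dC dD dM; elim/mpoly_ring_ind: P => [c|i|p q Hp Hq|p q Hp Hq].
- rewrite mmapC dC big1 // => j _; by rewrite mderivC !rmorph0 mul0r.
- rewrite mmapX mmap1U (bigD1 i) //= big1 => [|j ji].
    by rewrite mderivXU eqxx !rmorph1 mul1r addr0.
  by rewrite mderivXU eq_sym (negPf ji) !rmorph0 mul0r.
- rewrite rmorphD dD Hp Hq -big_split /=; apply: eq_bigr => j _.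
  by rewrite mderivD !rmorphD mulrDl.
- rewrite rmorphM dM Hp Hq mulr_suml mulr_sumr -big_split /=.
  apply: eq_bigr => j _; rewrite mderivM rmorphD rmorphD !rmorphM mulrDl.
  by rewrite -!mulrA [d _ * _]mulrC.
Qed.

End Derivations.

Lemma msize_mderiv (k : nzRingType) m (P : {mpoly k[m]}) j :
  P != 0 -> (msize P^`M(j) < msize P)%N.
Proof.
move=> P0; rewrite msizeE big_seq -(prednK (_ : 0 < msize P)%N); last first.
  by rewrite lt0n msize_poly_eq0.
rewrite ltnS; elim/big_ind: _ => // [x y xP yP|mu]; first by rewrite geq_max xP.
rewrite mcoeff_msupp mcoeff_deriv => muP.
have /msize_mdeg_lt : (mu + U_(j))%MM \in msupp P.
  by rewrite mcoeff_msupp; apply: contra_neq muP => ->; rewrite mul0rn.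
by rewrite mdegD mdeg1 addn1; case: (msize P).
Qed.

Section Jacobian.
Variables (k : fieldType) (A : comNzRingType) (iota : {rmorphism k -> A}).
Hypothesis char0 : [pchar k] =i pred0.

Lemma mderiv_eq0_const m (P : {mpoly k[m]}) :
  (forall j, P^`M(j) = 0) -> P = (P@_0%MM)%:MP.
Proof.
move=> dP; apply/mpolyP => mu; rewrite mcoeffC.
have [<-|mu0] := eqVneq 0%MM mu; first by rewrite mulr1.
have /existsP[j muj] : [exists j, mu j != 0%N].
  apply: contraNT mu0 => /existsPn/= mu0; apply/eqP/mnmP => j.
  by apply/esym/eqP; rewrite mnm0E -[_ == _]negbK mu0.
have muE : mu = ((mu - U_(j)) + U_(j))%MM.
  by apply/esym/submK/mnm_lepP => l; rewrite mnm1E; case: eqP => // <-; rewrite lt0n.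
have := mcoeff_deriv j (mu - U_(j))%MM P; rewrite -muE dP mcoeff0 => /esym/eqP.
rewrite mulr0 -mulr_natr mulf_eq0 => /orP[/eqP//|].
by have /pcharf0P -> := char0.
Qed.

(** The easy half of the Jacobian criterion.  Applying the derivations to a
    relation P(u) = 0 shows that the partial derivatives of P, which have
    smaller degree, are relations too; in characteristic 0 a polynomial all of
    whose partial derivatives vanish is constant.  Allowing P to involve only
    the variables in [S] is stable under differentiation and lets the other
    entries of [u] be arbitrary. *)
Lemma jacobian_independent (I : Type) m (D : I -> A -> A) (S : pred 'I_m)
    (u : 'I_m -> A) (P : {mpoly k[m]}) :
  (forall i, derivation_along iota idfun (D i)) ->
  (forall a : 'I_m -> A, (forall j, j \notin S -> a j = 0) ->
     (forall i, \sum_j a j * D i (u j) = 0) -> forall j, a j = 0) ->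
  (forall j, j \notin S -> P^`M(j) = 0) -> mmap iota u P = 0 -> P = 0.
Proof.
move=> derD indep; have [N] := ubnP (msize P); elim: N P => // N IH P.
rewrite ltnS => PN PS Pu; apply/eqP; apply: contraT => P0.
have dP j : P^`M(j) = 0.
  apply: IH.
  - exact: leq_trans (msize_mderiv j P0) PN.
  - by move=> l lS; rewrite mderiv_comm PS // mderiv0.
  - apply: (indep (fun j => mmap iota u P^`M(j))) => [l /PS ->|i].
      by rewrite rmorph0.
    have := chain_rule u P (derD i); rewrite Pu /= => <-.
    by have [/(_ 0)] := derD i; rewrite rmorph0.
have PE := mderiv_eq0_const dP; move: Pu P0; rewrite PE mmapC.
by move/eqP; rewrite fmorph_eq0 mpolyC_eq0 => ->.
Qed.

Lemma minimal_relation m (u : 'I_m -> A) :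
  (exists2 P : {mpoly k[m]}, P != 0 & mmap iota u P = 0) ->
  exists P : {mpoly k[m]}, [/\ P != 0, mmap iota u P = 0
    & forall Q, mmap iota u Q = 0 -> (msize Q < msize P)%N -> Q = 0].
Proof.
move=> [P P0 Pu]; have [N] := ubnP (msize P).
elim: N P P0 Pu => // N IH P P0 Pu; rewrite ltnS => PN.
have [[Q [Qu QP Q0]]|minP] := pselect (exists Q : {mpoly k[m]},
    [/\ mmap iota u Q = 0, (msize Q < msize P)%N & Q != 0]).
  by apply: (IH Q) => //; apply: leq_trans QP PN.
exists P; split=> // Q Qu QP; apply/eqP/contraT => Q0; case: minP.
by exists Q.
Qed.

(** In a relation P of minimal degree the derivative of P in the variable j0 is
    not a relation, since otherwise P would be free of that variable and
    contradict the independence of the remaining entries. *)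
Lemma separable_relation (I : Type) m (D : I -> A -> A) (j0 : 'I_m)
    (u : 'I_m -> A) :
  (forall i, derivation_along iota idfun (D i)) ->
  (forall a : 'I_m -> A, a j0 = 0 ->
     (forall i, \sum_j a j * D i (u j) = 0) -> forall j, a j = 0) ->
  (exists2 P : {mpoly k[m]}, P != 0 & mmap iota u P = 0) ->
  exists2 P : {mpoly k[m]}, mmap iota u P = 0 & mmap iota u P^`M(j0) != 0.
Proof.
move=> derD indep /minimal_relation[P [P0 Pu minP]]; exists P => //.
apply: contra_neq P0 => dPu.
have dP : P^`M(j0) = 0.
  have [->|P0] := eqVneq P 0; first by rewrite mderiv0.
  by apply: minP => //; exact: msize_mderiv.
apply: (jacobian_independent (S := predC1 j0) derD _ _ Pu) => [a aS|j].
  by apply: indep; apply: aS; rewrite !inE eqxx.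
by rewrite !inE negbK => /eqP ->.
Qed.

End Jacobian.

Section Char0.
Variable k : fieldType.
Hypothesis char0 : [pchar k] =i pred0.

Lemma natr_inj_char0 : injective (fun i : nat => i%:R : k).
Proof.
have natr0 : forall i, (i%:R == 0 :> k) = (i == 0%N) by apply/pcharf0P.
move=> i j ij; wlog ij' : i j ij / (i <= j)%N.
  by move=> W; case: (leqP i j) => [/(W _ _ ij)//|/ltnW/(W _ _ (esym ij))].
apply/eqP; rewrite eqn_leq ij' /= -subn_eq0 -natr0 natrB //.
by rewrite ij subrr.
Qed.

Lemma poly_eq0_char0 (p : {poly k}) : (forall t, p.[t] = 0) -> p = 0.
Proof.
move=> p0; apply: (@roots_geq_poly_eq0 _ _ [seq i%:R | i <- iota 0 (size p)]).
- by apply/allP => t _; rewrite /root p0.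
- by rewrite map_inj_uniq ?iota_uniq //; exact: natr_inj_char0.
- by rewrite size_map size_iota.
Qed.

Lemma poly_ext_char0 (p q : {poly k}) : (forall t, p.[t] = q.[t]) -> p = q.
Proof.
move=> pq; apply/eqP; rewrite -subr_eq0; apply/eqP/poly_eq0_char0 => t.
by rewrite hornerD hornerN pq subrr.
Qed.

End Char0.

Lemma derivation_horner (k A B : comNzRingType) (iota : {rmorphism k -> A})
    (ev : {rmorphism A -> B}) (d : A -> B) (q : {poly k}) (a : A) :
  derivation_along iota ev d ->
  d (map_poly iota q).[a] = ev (map_poly iota q^`()).[a] * d a.
Proof.
case=> dC dD dM; elim/poly_ind: q => [|q c IH].
  by rewrite !raddf0 !horner0 rmorph0 mul0r -(rmorph0 iota) dC.
rewrite !rmorphD !rmorphM /= map_polyX map_polyC hornerD hornerMX hornerC.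
rewrite dD dM dC addr0 IH derivMXaddC rmorphD rmorphM /= map_polyX.
by rewrite hornerD hornerMX rmorphD rmorphM mulrDl addrC; congr (_ + _); rewrite mulrAC.
Qed.

Section Lines.
Variables (k : fieldType).

(** Taking the linear coefficient is the derivation d/dt at t = 0; through it
    partial derivatives of polynomials are read off from restrictions to lines. *)
Lemma coef1_derivation :
  derivation_along (@polyC k) (horner_eval 0) (fun q : {poly k} => q`_1).
Proof.
split=> [c|p q|p q]; first by rewrite coefC.
  by rewrite coefD.
by rewrite coefM big_ord_recl big_ord1 /= /horner_eval !horner_coef0 addrC.
Qed.

Definition line d (t : 'I_d -> k) l (j : 'I_d) : {poly k} :=
  (t j)%:P + (j == l)%:R *: 'X.

Lemma horner_line d (t : 'I_d -> k) l (p : {mpoly k[d]}) s :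
  (mmap (@polyC k) (line t l) p).[s] = p.@[fun j => t j + (j == l)%:R * s].
Proof.
elim/mpoly_ring_ind: p => [c|i|p q hp hq|p q hp hq].
- by rewrite mmapC hornerC mevalC.
- by rewrite mmapX mmap1U mevalXU /line !hornerE.
- by rewrite !rmorphD /= hornerD hp hq.
- by rewrite !rmorphM /= hornerM hp hq.
Qed.

Lemma mderiv_line d (t : 'I_d -> k) l (p : {mpoly k[d]}) :
  (mmap (@polyC k) (line t l) p)`_1 = (p^`M(l)).@[t].
Proof.
rewrite (chain_rule _ _ coef1_derivation) (bigD1 l) //= big1 => [|j jl].
  rewrite /line coefD coefC coefZ coefX eqxx !mulr1 add0r addr0 /horner_eval.
  by rewrite mulr1 horner_line; apply: meval_eq => j; rewrite mulr0 addr0.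
by rewrite /line (negPf jl) scale0r addr0 coefC mulr0.
Qed.

Hypothesis char0 : [pchar k] =i pred0.

(** The partial derivatives also vanish identically, by restriction to lines, so
    induction on the degree reduces to the case of a constant. *)
Lemma mpoly_eq0_char0 d (p : {mpoly k[d]}) : (forall t, p.@[t] = 0) -> p = 0.
Proof.
have [N] := ubnP (msize p); elim: N p => // N IH p; rewrite ltnS => pN p0.
apply/eqP/negPn/negP => pn0.
have dp j : p^`M(j) = 0.
  apply: IH => [|t]; first exact: leq_trans (msize_mderiv j pn0) pN.
  rewrite -mderiv_line; suff -> : mmap (@polyC k) (line t j) p = 0 by rewrite coef0.
  by apply: poly_eq0_char0 => // s; rewrite horner_line.
case/eqP: pn0; have pE := mderiv_eq0_const char0 dp.
by have := p0 (fun=> 0); rewrite pE mevalC => ->.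
Qed.

End Lines.

(** * Linear algebra over an integral domain *)

Section CommonDenominators.
Variable R : idomainType.

Lemma fraction_quotient (x : {fraction R}) :
  exists a b : R, b != 0 /\ x = a%:F / b%:F.
Proof.
exists (\n_(repr x)), (\d_(repr x)); split; first exact: denom_ratioP.
exact: repr_numden.
Qed.

Lemma common_denominator (I : finType) (x : I -> {fraction R}) :
  exists2 g : R, g != 0 & exists a : I -> R, forall i, g%:F * x i = (a i)%:F.
Proof.
have /choice[a /choice[b abP]] := fun i => fraction_quotient (x i).
exists (\prod_i b i); first by apply/prodf_neq0 => i _; case: (abP i).
exists (fun i => (\prod_(j | j != i) b j) * a i) => i.
have [bi ->] := abP i.
rewrite (bigD1 i) //= !rmorphM /= [X in X * _]mulrC -mulrA [X in _ * X]mulrC.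
by rewrite divfK ?tofrac_eq0.
Qed.

(** A solution exists over the fraction field; clearing denominators keeps it
    nonzero. *)
Lemma underdetermined_system (I J : finType) (f : I -> J -> R) :
  (#|J| < #|I|)%N ->
  exists2 a : I -> R, (exists i, a i != 0) & forall j, \sum_i a i * f i j = 0.
Proof.
move=> JI.
pose A : 'M[{fraction R}]_(#|I|, #|J|) :=
  \matrix_(i, j) (f (enum_val i) (enum_val j))%:F.
have : kermx A != 0.
  rewrite kermx_eq0; apply: contraTN JI => /eqP <-; rewrite -leqNgt.
  exact: rank_leq_col.
case/rowV0Pn => v /sub_kermxP vA v0.
have [g g0 [a aE]] := common_denominator (fun i => v 0 (enum_rank i)).
exists a.
  have /rowV0Pn[w] : v != 0 by [].
  move=> _ _; have /existsP[i vi] : [exists i, v 0 i != 0].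
    apply: contraNT v0 => /existsPn/= v0; apply/eqP/rowP => i.
    by rewrite mxE; apply/eqP; rewrite -[_ == _]negbK v0.
  exists (enum_val i); rewrite -tofrac_eq0 -aE enum_valK mulf_neq0 //.
  by rewrite tofrac_eq0.
move=> j; apply/eqP; rewrite -tofrac_eq0 rmorph_sum /=; apply/eqP.
have /rowP/(_ (enum_rank j)) := vA; rewrite !mxE => vAj.
rewrite (reindex _ (onW_bij _ (enum_val_bij _))) /=.
rewrite -[RHS](mulr0 g%:F) -[X in _ * X]vAj mulr_sumr; apply: eq_bigr => i _.
by rewrite rmorphM /= -aE enum_valK !mxE enum_rankK mulrA.
Qed.

End CommonDenominators.

Section DomainLinearAlgebra.
Variables (R : idomainType) (r n : nat) (A : 'I_r -> 'I_n -> R).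
Let M : 'M[{fraction R}]_(r, n) := \matrix_(j, i) (A j i)%:F.

(** Membership in the row space over the fraction field, tested on the
    annihilator of the rows.  The test is a family of linear conditions on [v],
    hence passes to the coefficients when [v] depends polynomially on a
    parameter. *)
Lemma row_of_annihilator (v : 'I_n -> R) :
  (forall c : 'I_n -> R, (forall j, \sum_i A j i * c i = 0) ->
     \sum_i v i * c i = 0) ->
  exists2 g, g != 0 & exists b : 'I_r -> R, forall i, g * v i = \sum_j b j * A j i.
Proof.
move=> vA; pose w : 'rV[{fraction R}]_n := \row_i (v i)%:F.
have /submxP[d wE] : (w <= M)%MS.
  rewrite submxE; apply/eqP/rowP => l; rewrite !mxE.
  have [g g0 [c cE]] := common_denominator (fun i => cokermx M i l).
  have gF : g%:F != 0 by rewrite tofrac_eq0.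
  apply: (mulfI gF); rewrite mulr0 mulr_sumr.
  have -> : \sum_i g%:F * (w 0 i * cokermx M i l) = (\sum_i v i * c i)%:F.
    rewrite rmorph_sum; apply: eq_bigr => i _.
    by rewrite rmorphM /= -cE mxE mulrCA.
  rewrite vA ?rmorph0 // => j; apply/eqP; rewrite -tofrac_eq0 rmorph_sum /=.
  have /matrixP/(_ j l) := mulmx_coker M; rewrite !mxE => Mjl.
  rewrite -[X in _ == X](mulr0 g%:F) -[X in _ == _ * X]Mjl mulr_sumr.
  by apply/eqP/eq_bigr => i _; rewrite rmorphM /= -cE ?mxE mulrCA.
have [g g0 [b bE]] := common_denominator (fun j => d 0 j).
exists g => //; exists b => i; apply/eqP; rewrite -tofrac_eq rmorphM rmorph_sum /=.
have /rowP/(_ i) := wE; rewrite !mxE => ->; rewrite mulr_sumr.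
by apply/eqP/eq_bigr => j _; rewrite rmorphM /= -bE !mxE mulrA.
Qed.

Definition free_rows :=
  forall b : 'I_r -> R, (forall i, \sum_j b j * A j i = 0) -> forall j, b j = 0.

Lemma free_rows_leq : free_rows -> (r <= n)%N.
Proof.
move=> freeA; rewrite leqNgt; apply/negP => nr.
have [|b [j bj] /freeA b0] := underdetermined_system A; first by rewrite !card_ord.
by move: bj; rewrite b0 eqxx.
Qed.

Lemma free_rows_minor : free_rows ->
  exists f : 'I_r -> 'I_n, \det (\matrix_(i, j) A i (f j)) != 0.
Proof.
move=> freeA.
have freeM : row_free M.
  rewrite -kermx_eq0; apply: contraT => /rowV0Pn[v /sub_kermxP vM v0].
  have [g g0 [b bE]] := common_denominator (fun j => v 0 j).
  have b0 : forall j, b j = 0.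
    apply: freeA => i; apply/eqP; rewrite -tofrac_eq0 rmorph_sum /=.
    have /rowP/(_ i) := vM; rewrite !mxE => vMi.
    rewrite -[X in _ == X](mulr0 g%:F) -[X in _ == _ * X]vMi mulr_sumr.
    by apply/eqP/eq_bigr => j _; rewrite rmorphM /= -bE mxE mulrA.
  case/eqP: v0; apply/rowP => j; rewrite mxE; have := bE j.
  by rewrite b0 rmorph0 => /eqP; rewrite mulf_eq0 tofrac_eq0 (negPf g0) => /eqP.
have fullM : row_full M^T by rewrite /row_full mxrank_tr.
exists (fullrankfun fullM); have := fullrowsub_unit fullM.
rewrite unitmxE unitfE -det_tr; apply: contra_neq => det0.
rewrite -[RHS](rmorph0 (@FracField.tofrac R)) -det0 -det_map_mx; congr (\det _).
by apply/matrixP => i j; rewrite !mxE.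
Qed.

End DomainLinearAlgebra.

Lemma det_neq0_free (R : idomainType) r (N : 'M[R]_r) (a : 'I_r -> R) :
  \det N != 0 -> (forall i, \sum_j N i j * a j = 0) -> forall j, a j = 0.
Proof.
move=> detN Na j; pose v : 'cV[R]_r := \col_j a j.
have Nv : N *m v = 0.
  by apply/colP => i; rewrite !mxE -[RHS](Na i); apply: eq_bigr => l _; rewrite mxE.
have := congr1 (mulmx (\adj N)) Nv; rewrite mulmxA mul_adj_mx mulmx0 mul_scalar_mx.
move=> /colP/(_ j); rewrite !mxE => /eqP; rewrite mulf_eq0 (negPf detN).
by move=> /eqP.
Qed.

Definition extend_fun (T : Type) r (u : 'I_r -> T) (z : T) (j : 'I_r.+1) : T :=
  if unlift ord_max j is Some j' then u j' else z.

Lemma extend_fun_max T r (u : 'I_r -> T) z : extend_fun u z ord_max = z.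
Proof. by rewrite /extend_fun unlift_none. Qed.

Lemma extend_fun_lift T r (u : 'I_r -> T) z j :
  extend_fun u z (lift ord_max j) = u j.
Proof. by rewrite /extend_fun liftK. Qed.

(** Independence of the first r columns, in the form that the Jacobian criterion
    asks for when an arbitrary last element is added. *)
Lemma minor_extend (A : idomainType) r (D : 'I_r -> A -> A) (u : 'I_r -> A) z
    (a : 'I_r.+1 -> A) :
  \det (\matrix_(i, j) D i (u j)) != 0 -> a ord_max = 0 ->
  (forall i, \sum_j a j * D i (extend_fun u z j) = 0) -> forall j, a j = 0.
Proof.
move=> detD am aE j; case: (unliftP ord_max j) => [j' ->|->//].
apply: (det_neq0_free (a := fun j => a (lift ord_max j)) detD) => i.
rewrite -[RHS](aE i) (bigD1 ord_max) //= am mul0r add0r.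
rewrite [RHS](eq_bigl (fun j => j != ord_max)) //.
rewrite [RHS](reindex_omap (lift ord_max) (unlift ord_max)) /=; last first.
  by move=> l lm; case: unliftP lm => [l' -> //|->]; rewrite eqxx.
apply: eq_big => [l|l _]; first by rewrite liftK eqxx eq_sym neq_lift.
by rewrite mxE extend_fun_lift mulrC.
Qed.

Section LastVariable.
Variables (k : fieldType) (d : nat).

Definition drop_last (P : {mpoly k[d.+1]}) : {mpoly k[d.+1]} :=
  mmap (@mpolyC _ k) (extend_fun (fun j => 'X_(lift ord_max j)) 0) P.

Lemma drop_last_div P : exists Q, P = drop_last P + 'X_ord_max * Q.
Proof.
elim/mpoly_ring_ind: P => [c|i|p q [p1 hp] [q1 hq]|p q [p1 hp] [q1 hq]].
- by exists 0; rewrite /drop_last mmapC mulr0 addr0.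
- rewrite /drop_last mmapX mmap1U; case: (unliftP ord_max i) => [j|] ->.
    by exists 0; rewrite extend_fun_lift mulr0 addr0.
  by exists 1; rewrite extend_fun_max mulr1 add0r.
- exists (p1 + q1); rewrite {1}hp {1}hq /drop_last rmorphD mulrDr.
  by rewrite addrACA.
- exists (drop_last p * q1 + p1 * drop_last q + 'X_ord_max * p1 * q1).
  rewrite {1}hp {1}hq /drop_last rmorphM /=; ring.
Qed.

Lemma mderiv_drop_last P : (drop_last P)^`M(ord_max) = 0.
Proof.
rewrite /drop_last; elim/mpoly_ring_ind: P => [c|i|p q hp hq|p q hp hq].
- by rewrite mmapC mderivC.
- rewrite mmapX mmap1U; case: (unliftP ord_max i) => [j|] ->.
    by rewrite extend_fun_lift mderivXU eq_sym (negPf (neq_lift _ _)).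
  by rewrite extend_fun_max mderiv0.
- by rewrite rmorphD mderivD hp hq addr0.
- by rewrite rmorphM mderivM hp hq mul0r mulr0 addr0.
Qed.

End LastVariable.

(** * Words in derivations *)

Section OperatorSpan.
Variable R : idomainType.
Implicit Types (Q : R -> R) (B : (R -> R) -> Prop).

(** The span over the fraction field, inside the operators on R.  The last
    constructor divides by g without leaving R, so that derivations need not be
    extended to fractions. *)
Inductive opspan B : (R -> R) -> Prop :=
| Opspan_in Q : B Q -> opspan B Q
| Opspan_zero : opspan B (fun=> 0)
| Opspan_add Q1 Q2 : opspan B Q1 -> opspan B Q2 ->
    opspan B (fun u => Q1 u + Q2 u)
| Opspan_scale a Q : opspan B Q -> opspan B (fun u => a * Q u)
| Opspan_div g Q : g != 0 -> opspan B (fun u => g * Q u) -> opspan B Q.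

Lemma opspan_sub B1 B2 :
  (forall Q, B1 Q -> opspan B2 Q) -> forall Q, opspan B1 Q -> opspan B2 Q.
Proof.
move=> B12 Q; elim=> {Q} [Q /B12//||Q1 Q2 _ h1 _ h2|a Q _ h|g Q g0 _ h].
- exact: Opspan_zero.
- exact: Opspan_add.
- exact: Opspan_scale.
- exact: Opspan_div h.
Qed.

Lemma opspan_sum B (I : Type) (s : seq I) (Q : I -> R -> R) :
  (forall i, opspan B (Q i)) -> opspan B (fun u => \sum_(i <- s) Q i u).
Proof.
move=> BQ; elim: s => [|i s IH].
  rewrite (_ : (fun u => _) = fun=> 0); first exact: Opspan_zero.
  by apply/funext => u; rewrite big_nil.
rewrite (_ : (fun u => _) = fun u => Q i u + \sum_(i <- s) Q i u).
  exact: Opspan_add.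
by apply/funext => u; rewrite big_cons.
Qed.

Definition derivation (d : R -> R) :=
  (forall a b, d (a + b) = d a + d b) /\
  (forall a b, d (a * b) = d a * b + a * d b).

Lemma derivation0 d : derivation d -> d 0 = 0.
Proof. by case=> dD _; apply: (addrI (d 0)); rewrite -dD !addr0. Qed.

Lemma derivationB d a b : derivation d -> d (a - b) = d a - d b.
Proof.
by move=> dd; apply: (addIr (d b)); rewrite subrK -(proj1 dd) subrK.
Qed.

(** Composing with a derivation d on the left is not linear over R: the Leibniz
    rule d (a Q) = d a Q + a (d Q) brings back the span of B1 itself, which is
    why [B2] has to contain it. *)
Lemma opspan_comp B1 B2 d : derivation d ->
  (forall Q, B1 Q -> opspan B2 Q /\ opspan B2 (d \o Q)) ->
  forall Q, opspan B1 Q -> opspan B2 (d \o Q).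
Proof.
move=> dd B12 Q BQ; suff: opspan B2 Q /\ opspan B2 (d \o Q) by case.
have [dD dM] := dd.
elim: BQ => {Q} [Q /B12//||Q1 Q2 _ [h1 h1'] _ [h2 h2']|a Q _ [h h']
               |g Q g0 _ [h h']].
- split; first exact: Opspan_zero.
  rewrite (_ : _ \o _ = fun=> 0); first exact: Opspan_zero.
  by apply/funext => u /=; rewrite derivation0.
- split; first exact: Opspan_add.
  rewrite (_ : _ \o _ = fun u => (d \o Q1) u + (d \o Q2) u).
    exact: Opspan_add.
  by apply/funext => u /=; rewrite dD.
- split; first exact: Opspan_scale.
  rewrite (_ : _ \o _ = fun u => d a * Q u + a * (d \o Q) u).
    by apply: Opspan_add; apply: Opspan_scale.
  by apply/funext => u /=; rewrite dM.
- have hQ := Opspan_div g0 h; split=> //; apply: (Opspan_div g0).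
  rewrite (_ : (fun u => _) = fun u => (d \o (fun u => g * Q u)) u + - d g * Q u).
    by apply: Opspan_add => //; apply: Opspan_scale.
  by apply/funext => u /=; rewrite dM mulNr addrC addKr.
Qed.

End OperatorSpan.

Section OrderedWords.
Variables (R : idomainType) (r : nat) (D : 'I_r -> R -> R).
Hypothesis derD : forall i, derivation (D i).
Hypothesis bracketD : forall i j, exists2 g, g != 0 & exists b : 'I_r -> R,
  forall u, g * (D i (D j u) - D j (D i u)) = \sum_l b l * D l u.

Definition opword (I : Type) (E : I -> R -> R) (w : seq I) : R -> R :=
  foldr (fun i Q => E i \o Q) id w.

Definition words_upto N Q := exists2 w : seq 'I_r, (size w <= N)%N & Q = opword D w.

Lemma words_upto_comp i N Q :
  opspan (words_upto N) Q -> opspan (words_upto N.+1) (D i \o Q).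
Proof.
apply: opspan_comp => // {}Q [w wN ->]; split; apply: Opspan_in.
  by exists w => //; exact: leqW.
by exists (i :: w).
Qed.

Lemma bracket_word i j w :
  opspan (words_upto (size w).+1)
    (fun u => D i (D j (opword D w u)) - D j (D i (opword D w u))).
Proof.
have [g g0 [b bE]] := bracketD i j; apply: (Opspan_div g0).
rewrite (_ : (fun u => _) = fun u => \sum_l b l * opword D (l :: w) u).
  apply: opspan_sum => l; apply: Opspan_scale; apply: Opspan_in.
  by exists (l :: w).
by apply/funext => u; rewrite bE.
Qed.

Fixpoint insert_word (j : 'I_r) (w : seq 'I_r) :=
  if w is i :: w' then
    if (j <= i)%N then j :: w else i :: insert_word j w'
  else [:: j].

Lemma perm_insert_word j w : perm_eq (insert_word j w) (j :: w).
Proof.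
elim: w => //= i w IH; case: ifP => // _.
rewrite (perm_trans (y := i :: j :: w)) ?perm_cons //.
by rewrite -cat1s -(cat1s j) -[j :: i :: w]/([:: j] ++ [:: i] ++ w) perm_catCA.
Qed.

Definition word_le : rel 'I_r := fun i j => (i <= j)%N.

Lemma sorted_insert_word j w :
  sorted word_le w -> sorted word_le (insert_word j w).
Proof.
case: w => //= i w; rewrite /word_le; case: leqP => [ji|/ltnW ij] /=.
  by rewrite ji.
elim: w i ij => [|l w IH] i ij /=; first by rewrite ij.
by move=> /andP[il lw]; case: leqP => [jl|/ltnW lj] /=; rewrite ?ij ?jl ?il ?IH.
Qed.

(** Swapping two neighbours costs a bracket, which is a combination of shorter
    words. *)
Lemma insert_word_mod j w :
  opspan (words_upto (size w))
    (fun u => opword D (j :: w) u - opword D (insert_word j w) u).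
Proof.
elim: w => [|i w IH] /=.
  rewrite (_ : (fun u => _) = fun=> 0); first exact: Opspan_zero.
  by apply/funext => u /=; rewrite subrr.
case: ifP => _.
  rewrite (_ : (fun u => _) = fun=> 0); first exact: Opspan_zero.
  by apply/funext => u /=; rewrite subrr.
rewrite (_ : (fun u => _) = fun u =>
  (D j (D i (opword D w u)) - D i (D j (opword D w u))) +
  (D i \o (fun u => opword D (j :: w) u - opword D (insert_word j w) u)) u).
  by apply: Opspan_add; [exact: bracket_word|exact: words_upto_comp].
by apply/funext => u /=; rewrite derivationB // addrA subrK.
Qed.

Definition sorted_words N Q :=
  exists2 w : seq 'I_r, sorted word_le w && (size w <= N)%N & Q = opword D w.

(** Ordered monomials span all composites.  By induction on the length the tail
    of a word is a combination of sorted words; putting the head in its place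
    costs brackets, which are combinations of shorter words. *)
Lemma word_mod_sorted N w : (size w <= N)%N ->
  opspan (sorted_words N) (opword D w).
Proof.
elim: N w => [|N IH] w.
  by case: w => // _; apply: Opspan_in; exists [::].
have up Q : opspan (sorted_words N) Q -> opspan (sorted_words N.+1) Q.
  apply: opspan_sub => {}Q [v /andP[vs vN] ->]; apply: Opspan_in.
  by exists v; rewrite // vs leqW.
case: w => [|j w wN]; first by move=> _; apply: Opspan_in; exists [::].
apply: (opspan_comp (derD j) _ (IH w wN)) => _ [s /andP[ss sN] ->].
split; first by apply/up/IH.
rewrite (_ : _ \o _ = fun u =>
  (opword D (j :: s) u - opword D (insert_word j s) u) +
  opword D (insert_word j s) u); last by apply/funext => u; rewrite subrK.
apply: Opspan_add.
  apply/up; apply: opspan_sub (insert_word_mod j s) => _ [v vs ->].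
  by apply: IH; exact: leq_trans sN.
apply: Opspan_in; exists (insert_word j s) => //.
by rewrite sorted_insert_word //= (perm_size (perm_insert_word j s)).
Qed.

(** The passage from the D_i to all derivations in their span. *)
Lemma word_of_span (I : Type) (E : I -> R -> R) (w : seq I) :
  (forall i, exists2 g, g != 0 & exists b : 'I_r -> R,
     forall u, g * E i u = \sum_l b l * D l u) ->
  opspan (fun Q => exists2 s, sorted word_le s & Q = opword D s) (opword E w).
Proof.
move=> ED.
suff: opspan (words_upto (size w)) (opword E w).
  apply: opspan_sub => _ [v vw ->].
  apply: opspan_sub (word_mod_sorted vw) => _ [s /andP[ss _] ->].
  by apply: Opspan_in; exists s.
elim: w => [|i w IH]; first by apply: Opspan_in; exists [::].
have [g g0 [b bE]] := ED i; apply: (Opspan_div g0).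
rewrite (_ : (fun u => _) = fun u => \sum_l b l * (D l \o opword E w) u).
  by apply: opspan_sum => l; apply: Opspan_scale; exact: words_upto_comp.
by apply/funext => u; rewrite /= bE.
Qed.

End OrderedWords.

Section DegreeBound.
Variables (R : idomainType) (r : nat) (D : 'I_r -> R -> R).
Hypothesis derD : forall i, derivation (D i).
Hypothesis nilD : forall i u, exists N, forall j, (N <= j)%N -> iter j (D i) u = 0.

(** [degree_le l e u] says that u has degree at most e in every variable of the
    polynomial t |-> prod_i exp (t_i D_i) u, where the first element of [l] acts
    first. *)
Fixpoint degree_le (l : seq 'I_r) (e : nat) (u : R) : Prop :=
  if l is i :: l' then
    (forall j, (e < j)%N -> iter j (D i) u = 0) /\
    (forall j, degree_le l' e (iter j (D i) u))
  else True.

Lemma iter_derivationD i j u v :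
  iter j (D i) (u + v) = iter j (D i) u + iter j (D i) v.
Proof. by elim: j => //= j ->; have [-> _] := derD i. Qed.

Lemma iter_derivation0 i j : iter j (D i) 0 = 0.
Proof. by elim: j => //= j ->; exact: derivation0. Qed.

Lemma degree_le0 l e : degree_le l e 0.
Proof.
by elim: l => //= i l IH; split=> j; rewrite iter_derivation0.
Qed.

Lemma degree_leD l e u v :
  degree_le l e u -> degree_le l e v -> degree_le l e (u + v).
Proof.
elim: l u v => //= i l IH u v [u1 u2] [v1 v2]; split=> j; rewrite iter_derivationD.
  by move=> ej; rewrite u1 // v1 // addr0.
exact: IH.
Qed.

Lemma degree_leW l e f u : (e <= f)%N -> degree_le l e u -> degree_le l f u.
Proof.
move=> ef; elim: l u => //= i l IH u [u1 u2]; split=> j.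
  by move=> fj; apply: u1; exact: leq_ltn_trans fj.
exact: IH.
Qed.

(** The Leibniz formula for iterates, without its binomial coefficients: it is
    only used for properties stable under sums. *)
Lemma iter_derivationM i (P : R -> Prop) j u v :
  (forall u v, P u -> P v -> P (u + v)) ->
  (forall a b, (a + b)%N = j -> P (iter a (D i) u * iter b (D i) v)) ->
  P (iter j (D i) (u * v)).
Proof.
move=> PD; elim: j u v => [|j IH] u v Puv; first exact: (Puv 0%N 0%N).
rewrite iterSr; have [_ ->] := derD i; rewrite iter_derivationD.
apply: PD; apply: IH => a b abj.
  by have := Puv a.+1 b; rewrite iterSr; apply; rewrite addSn abj.
by have := Puv a b.+1; rewrite iterSr; apply; rewrite addnS abj.
Qed.

Lemma degree_leM l e f u v :
  degree_le l e u -> degree_le l f v -> degree_le l (e + f)%N (u * v).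
Proof.
elim: l u v => //= i l IH u v [u1 u2] [v1 v2]; split=> j.
  move=> efj; apply: (iter_derivationM (P := fun w => w = 0)).
    by move=> ? ? -> ->; rewrite addr0.
  move=> a b abj; have [ea|ae] := ltnP e a; first by rewrite u1 // mul0r.
  rewrite v1 ?mulr0 //; rewrite -abj in efj.
  by rewrite -(ltn_add2l e) (leq_trans efj) // leq_add2r.
apply: iter_derivationM; first exact: degree_leD.
by move=> a b _; apply: IH.
Qed.

Lemma degree_le1 l : degree_le l 0 1.
Proof.
have D1 i : D i 1 = 0.
  have [_ /(_ 1 1)] := derD i; rewrite !mulr1 mul1r => /eqP.
  by rewrite -{1}[D i 1]addr0 (inj_eq (addrI _)) eq_sym => /eqP.
elim: l => //= i l IH; split=> [[|j] //|[|j] //]; rewrite iterSr D1 iter_derivation0 //.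
exact: degree_le0.
Qed.

Lemma degree_leX l e u a : degree_le l e u -> degree_le l (e * a)%N (u ^+ a).
Proof.
move=> eu; elim: a => [|a IH]; first by rewrite muln0; exact: degree_le1.
by rewrite exprS mulnS; exact: degree_leM.
Qed.

Lemma degree_le_prod (I : Type) (s : seq I) l (e : I -> nat) (u : I -> R) :
  (forall i, degree_le l (e i) (u i)) ->
  degree_le l (\sum_(i <- s) e i)%N (\prod_(i <- s) u i).
Proof.
move=> eu; elim: s => [|i s IH]; rewrite ?big_nil ?big_cons.
  exact: degree_le1.
exact: degree_leM.
Qed.

Lemma degree_le_exists l u : exists e, degree_le l e u.
Proof.
elim: l u => [|i l IH] u; first by exists 0%N.
have [N uN] := nilD i u; have /choice[e eP] := fun j => IH (iter j (D i) u).
exists (maxn N (\max_(j < N) e j)); split=> j.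
  by rewrite gtn_max => /andP[/ltnW/uN].
have [/uN ->|jN] := leqP N j; first exact: degree_le0.
apply: degree_leW (eP j); rewrite leq_max; apply/orP; right.
exact: (leq_bigmax (Ordinal jN)).
Qed.

Definition power_word (l : seq 'I_r) (alpha : 'I_r -> nat) :=
  flatten [seq nseq (alpha i) i | i <- l].

Lemma power_word_eq0 l alpha e u i :
  degree_le (rev l) e u -> i \in l -> (e < alpha i)%N ->
  opword D (power_word l alpha) u = 0.
Proof.
have op0 w : opword D w 0 = 0.
  by elim: w => //= j w ->; exact: derivation0.
have op_cat s1 s2 v : opword D (s1 ++ s2) v = opword D s1 (opword D s2 v).
  by elim: s1 => //= j s ->.
have op_nseq a j v : opword D (nseq a j) v = iter a (D j) v.
  by elim: a => //= a ->.
elim/last_ind: l u => // l j IH u; rewrite rev_rcons /= => -[u1 u2].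
rewrite /power_word map_rcons flatten_rcons op_cat op_nseq mem_rcons inE.
have [-> _ /u1 ->|ij /= il ei] := eqVneq i j; first by rewrite op0.
exact: IH.
Qed.

Lemma sorted_power_word w : sorted (@word_le r) w ->
  w = power_word (enum 'I_r) (fun i => count_mem i w).
Proof.
have le_tr : transitive (@word_le r) by move=> ? ? ?; exact: leq_trans.
have le_anti : antisymmetric (@word_le r).
  by move=> i j /anti_leq/val_inj.
have pw l alpha : pairwise (@word_le r) l ->
    pairwise (@word_le r) (power_word l alpha).
  elim: l => //= i l IH /andP[/allP il /IH pl].
  rewrite /power_word /= pairwise_cat pl andbT; apply/andP; split.
    apply/allrelP => x y /nseqP[-> _] /flattenP[s /mapP[z zl ->] /nseqP[-> _]].
    exact: il.
  by elim: (alpha i) => //= a ->; rewrite all_nseq /word_le leqnn orbT.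
move=> sw; apply: (sorted_eq le_tr le_anti sw).
  rewrite (sorted_pairwise le_tr) pw // -(sorted_pairwise le_tr).
  have := iota_sorted 0 r; rewrite -val_enum_ord sorted_map.
  by apply: sub_sorted.
apply/allP => i _ /=; rewrite count_flatten -map_comp sumnE big_map.
rewrite big_enum /= (bigD1 i) //= big1 => [|j ji].
  by rewrite count_nseq /= eqxx mul1n addn0.
by rewrite count_nseq /= (negPf ji).
Qed.

(** The monomial of exponent beta in the fractions v_j / b, multiplied by the
    power of b that makes all these monomials regular at once. *)
Definition homogenized e N (b : R) (v : 'I_e -> R) (beta : {ffun 'I_e -> 'I_N}) :=
  b ^+ (e * N - \sum_j beta j)%N * \prod_j v j ^+ beta j.

(** The monomials number N^e, and by the degree bound only (C e N + 1)^r sorted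
    words act on them nontrivially. *)
Lemma too_many_monomials e (b : R) (v : 'I_e -> R) : (r < e)%N ->
  exists N, exists2 a : {ffun 'I_e -> 'I_N} -> R, (exists beta, a beta != 0) &
    forall w, sorted (@word_le r) w ->
      \sum_beta a beta * opword D w (homogenized b v beta) = 0.
Proof.
move=> re; pose l := rev (enum 'I_r).
have [C [Cb Cv]] : exists C, degree_le l C b /\ forall j, degree_le l C (v j).
  have [cb cbP] := degree_le_exists l b.
  have /choice[cv cvP] := fun j => degree_le_exists l (v j).
  exists (maxn cb (\max_j cv j)); split=> [|j].
    by apply: degree_leW cbP; rewrite leq_maxl.
  by apply: degree_leW (cvP j); rewrite leq_max leq_bigmax orbT.
(* As N exceeds (C e + 1)^r, (C e N + 1)^r <= (C e + 1)^r N^r < N^(r + 1) <= N^e. *)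
pose N := ((C * e)%N.+1 ^ r)%N.+1; pose M := (C * (e * N))%N.+1; exists N.
have degm (beta : {ffun 'I_e -> 'I_N}) :
    degree_le l (C * (e * N))%N (homogenized b v beta).
  have sb : (\sum_j beta j <= e * N)%N.
    rewrite -[X in (_ <= X * _)%N]card_ord -sum_nat_const.
    by apply: leq_sum => j _; exact: ltnW.
  rewrite -[X in degree_le _ (C * X)%N](subnK sb) mulnDr; apply: degree_leM.
    exact: degree_leX.
  rewrite big_distrr /=; apply: degree_le_prod => j; exact: degree_leX.
have card : (#|{ffun 'I_r -> 'I_M}| < #|{ffun 'I_e -> 'I_N}|)%N.
  rewrite !card_ffun !card_ord; apply: (@leq_ltn_trans (((C * e).+1 * N) ^ r)%N).
    have expW m1 m2 c : (m1 <= m2)%N -> (m1 ^ c <= m2 ^ c)%N.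
      by case: c => // c m12; rewrite leq_exp2r.
    by apply: expW; rewrite /M mulSn mulnA -add1n leq_add2r.
  rewrite expnMn; apply: (@leq_trans (N ^ r.+1)%N).
    by rewrite expnS ltn_pmul2r ?expn_gt0.
  by rewrite leq_pexp2l.
have [a a0 aE] := underdetermined_system
  (fun (beta : {ffun 'I_e -> 'I_N}) (alpha : {ffun 'I_r -> 'I_M}) =>
     opword D (power_word (enum 'I_r) (fun i => alpha i)) (homogenized b v beta)) card.
exists a => // w /sorted_power_word wE.
have [/existsP[i wi]|/existsPn wM] :=
    boolP [exists i, (C * (e * N) < count_mem i w)%N].
  rewrite big1 // => beta _; rewrite wE (power_word_eq0 (degm beta) _ wi) ?mulr0 //.
  exact: mem_enum.
have := aE [ffun i => inord (count_mem i w)].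
rewrite [X in opword D X](_ : _ = w) //= {2}wE /power_word.
congr flatten; apply: eq_map => i; rewrite ffunE inordK //.
by rewrite /M ltnS leqNgt wM.
Qed.

End DegreeBound.
(** * Regular functions and one-parameter families of them *)

Section RegularFunctionRing.
Variables (k : closedFieldType) (n : nat) (X : irr_affine_variety k n).
Local Notation R := (regular_function X).
Implicit Types (x y : X) (f g : R).

Definition eval_at x f : k := f x.
Arguments eval_at : simpl never.

Fact eval_at_is_zmod_morphism x : zmod_morphism (eval_at x).
Proof. by []. Qed.
HB.instance Definition _ x := GRing.isZmodMorphism.Build R k (eval_at x)
  (eval_at_is_zmod_morphism x).
Fact eval_at_is_monoid_morphism x : monoid_morphism (eval_at x).
Proof. by []. Qed.
HB.instance Definition _ x := GRing.isMonoidMorphism.Build R k (eval_at x)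
  (eval_at_is_monoid_morphism x).

Definition regular_const (c : k) : R := Regular (const_is_regular X c).

Fact regular_const_is_zmod_morphism : zmod_morphism regular_const.
Proof. by move=> c d; apply: regular_function_ext. Qed.
HB.instance Definition _ := GRing.isZmodMorphism.Build k R regular_const
  regular_const_is_zmod_morphism.
Fact regular_const_is_monoid_morphism : monoid_morphism regular_const.
Proof. by split=> [|c d]; apply: regular_function_ext. Qed.
HB.instance Definition _ := GRing.isMonoidMorphism.Build k R regular_const
  regular_const_is_monoid_morphism.

Lemma eval_at_const x c : eval_at x (regular_const c) = c.
Proof. by []. Qed.

Lemma regular_of_mpoly_subproof (p : {mpoly k[n]}) :
  is_regular (fun x : X => p.@[val x 0]).
Proof. by exists p. Qed.
Definition regular_of_mpoly p : R := Regular (regular_of_mpoly_subproof p).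

Definition coordinate i : R := regular_of_mpoly 'X_i.

Lemma eval_at_coordinate x i : eval_at x (coordinate i) = val x 0 i.
Proof. by rewrite /eval_at /= mevalXU. Qed.

Lemma eval_at_mmap x m (u : 'I_m -> R) (P : {mpoly k[m]}) :
  eval_at x (mmap regular_const u P) = P.@[fun j => eval_at x (u j)].
Proof.
elim/mpoly_ring_ind: P => [c|i|p q hp hq|p q hp hq].
- by rewrite mmapC mevalC.
- by rewrite mmapX mmap1U mevalXU.
- by rewrite !rmorphD /= hp hq.
- by rewrite !rmorphM /= hp hq.
Qed.

Lemma regular_mmap f : exists p, f = mmap regular_const coordinate p.
Proof.
have [p fp] := regular_function_is_regular f; exists p.
apply: regular_function_ext => x; rewrite -[RHS]/(eval_at x _) eval_at_mmap fp.
by apply: meval_eq => i; rewrite eval_at_coordinate.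
Qed.

Lemma neq0_point f : f != 0 -> exists x, eval_at x f != 0.
Proof.
move=> f0; apply: contrapT => nf; case/eqP: f0; apply: regular_function_ext => x.
by apply/eqP/negPn/negP => fx; apply: nf; exists x.
Qed.

(* Values of a one-parameter family of regular functions. *)
Definition family_at (p : {poly R}) (t : k) x : k := (map_poly (eval_at x) p).[t].

Hypothesis char0 : [pchar k] =i pred0.

Lemma family_at_ext (p q : {poly R}) :
  (forall t x, family_at p t x = family_at q t x) -> p = q.
Proof.
move=> pq; apply/polyP => i; apply: regular_function_ext => x.
rewrite -!/(eval_at x _) -!(coef_map (eval_at x)).
rewrite (_ : map_poly _ p = map_poly (eval_at x) q) //.
by apply: poly_ext_char0 => // t; exact: pq.
Qed.

End RegularFunctionRing.
Arguments eval_at {k n X} x f : simpl never.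

Section Pullback.
Variables (k : closedFieldType) (n : nat) (X : irr_affine_variety k n).
Local Notation R := (regular_function X).
Implicit Types (x y : X) (f : R) (g : automorphism X).

Fact pullback_is_zmod_morphism g : zmod_morphism (pullback g).
Proof. by move=> a b; apply: regular_function_ext. Qed.
HB.instance Definition _ g := GRing.isZmodMorphism.Build R R (pullback g)
  (pullback_is_zmod_morphism g).
Fact pullback_is_monoid_morphism g : monoid_morphism (pullback g).
Proof. by split=> [|a b]; apply: regular_function_ext. Qed.
HB.instance Definition _ g := GRing.isMonoidMorphism.Build R R (pullback g)
  (pullback_is_monoid_morphism g).

Lemma eval_pullback g f x : eval_at x (pullback g f) = eval_at (g x) f.
Proof. by []. Qed.

Definition action_family (phi : k -> automorphism X) (f : R) (p : {poly R}) :=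
  forall t x, eval_at (phi t x) f = family_at p t x.

(** An action is algebraic exactly when each regular function becomes a
    polynomial in the parameter with regular coefficients. *)
Lemma algebraic_actionP phi :
  algebraic_action phi <-> forall f, exists p, action_family phi f p.
Proof.
split=> [[P PE] f|fam].
  have [q ->] := regular_mmap f.
  pose to_fam (Q : {mpoly k[1 + n]}) : {poly R} :=
    mmap (polyC \o @regular_const _ _ X)
      (fun i => match fintype.split i with
                | inl _ => 'X | inr j => (coordinate X j)%:P end) Q.
  have to_famE Q t x : family_at (to_fam Q) t x = Q.@[row_mx t%:M (val x) 0].
    elim/mpoly_ring_ind: Q => [c|i|p r hp hr|p r hp hr].
    - by rewrite /to_fam mmapC /= /family_at map_polyC hornerC mevalC.
    - rewrite /to_fam mmapX mmap1U mevalXU /family_at mxE.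
      case: fintype.split => j; first by rewrite map_polyX hornerX mxE ord1 eqxx mulr1n.
      by rewrite map_polyC hornerC; exact: eval_at_coordinate.
    - by rewrite /to_fam /family_at !rmorphD /= -hp -hr /to_fam /family_at hornerD.
    - by rewrite /to_fam /family_at !rmorphM /= -hp -hr /to_fam /family_at hornerM.
  exists (mmap (polyC \o @regular_const _ _ X) (fun i => to_fam (P i)) q) => t x.
  elim/mpoly_ring_ind: q => [c|i|p r hp hr|p r hp hr].
  - by rewrite !mmapC /family_at map_polyC hornerC.
  - by rewrite !mmapX !mmap1U to_famE eval_at_coordinate PE.
  - by rewrite /family_at !rmorphD /= hp hr hornerD.
  - by rewrite /family_at !rmorphM /= hp hr hornerM.
have /choice[p pE] := fun i => fam (coordinate X i).
suff /choice[P PE] : forall i, exists P : {mpoly k[1 + n]}, forall t x,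
    P.@[row_mx t%:M (val x) 0] = family_at (p i) t x.
  by exists P => t x i; rewrite PE -pE eval_at_coordinate.
move=> i; elim/poly_ind: (p i) => [|q f [Q QE]].
  by exists 0 => t x; rewrite meval0 /family_at rmorph0 horner0.
have [c cE] := regular_function_is_regular f.
pose shift : {mpoly k[1 + n]} := mmap (@mpolyC _ _) (fun j => 'X_(rshift 1 j)) c.
have shiftE t x : shift.@[row_mx t%:M (val x) 0] = f x.
  rewrite cE /shift; elim/mpoly_ring_ind: c {cE shift} => [c|j|a b ha hb|a b ha hb].
  - by rewrite mmapC !mevalC.
  - by rewrite mmapX mmap1U !mevalXU row_mxEr.
  - by rewrite !rmorphD /= ha hb.
  - by rewrite !rmorphM /= ha hb.
exists (Q * 'X_(lshift n ord0) + shift) => t x.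
rewrite mevalD mevalM mevalXU row_mxEl mxE eqxx QE shiftE.
by rewrite /family_at rmorphD rmorphM /= map_polyX map_polyC hornerMXaddC.
Qed.

End Pullback.

(** * One-parameter unipotent subgroups as exponentials of derivations *)

Section OneParameter.
Variables (k : closedFieldType) (n : nat) (X : irr_affine_variety k n).
Local Notation R := (regular_function X).

Record one_param := OneParam {
  one_param_fun :> k -> automorphism X;
  one_param_inj : injective one_param_fun;
  one_param_morph : {morph one_param_fun : s t / s + t >-> (s * t)%g};
  one_param_algebraic : algebraic_action one_param_fun }.

HB.instance Definition _ := gen_eqMixin one_param.

Lemma one_paramP (H : set (automorphism X)) :
  one_param_unipotent H <-> exists phi : one_param, H = range phi.
Proof.
split=> [[phi [inj morph alg ->]]|[[phi inj morph alg] ->]].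
  by exists (OneParam inj morph alg).
by exists phi.
Qed.

Variable phi : one_param.

Lemma one_param0 x : phi 0 x = x.
Proof.
have := one_param_morph phi 0 0; rewrite addr0.
move=> /(congr1 (fun g : automorphism X => g x)).
by move/(can_inj (aut_funK (phi 0))) => /esym.
Qed.

Lemma one_paramD s t x : phi (s + t) x = phi s (phi t x).
Proof. by rewrite one_param_morph. Qed.

Definition flow (f : R) : {poly R} :=
  projT1 (cid (proj1 (algebraic_actionP phi) (one_param_algebraic phi) f)).

Lemma flowP f t x : family_at (flow f) t x = eval_at (phi t x) f.
Proof. by rewrite /flow; case: cid => p /= ->. Qed.

Definition lnd (f : R) : R := (flow f)`_1.

Hypothesis char0 : [pchar k] =i pred0.

Lemma flow_unique f p :
  (forall t x, family_at p t x = eval_at (phi t x) f) -> flow f = p.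
Proof. by move=> pE; apply: family_at_ext => // t x; rewrite flowP pE. Qed.

Lemma flowD f g : flow (f + g) = flow f + flow g.
Proof.
apply: flow_unique => t x.
by rewrite rmorphD /= -!flowP /family_at rmorphD hornerD.
Qed.

Lemma flowM f g : flow (f * g) = flow f * flow g.
Proof.
apply: flow_unique => t x.
by rewrite rmorphM /= -!flowP /family_at rmorphM hornerM.
Qed.

Lemma flow_const c : flow (regular_const X c) = (regular_const X c)%:P.
Proof.
by apply: flow_unique => t x; rewrite /family_at map_polyC hornerC.
Qed.

Lemma flow_coef0 f : (flow f)`_0 = f.
Proof.
apply: regular_function_ext => x; rewrite -[LHS]/(eval_at x _).
rewrite -(coef_map (eval_at x)) -horner_coef0 -[LHS]/(family_at _ _ _).
by rewrite flowP one_param0.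
Qed.

Lemma lnd_derivation : derivation_along (regular_const X) idfun lnd.
Proof.
split=> [c|f g|f g]; rewrite /lnd.
- by rewrite flow_const coefC.
- by rewrite flowD coefD.
- rewrite flowM coefM big_ord_recl big_ord1 /= !flow_coef0.
  by rewrite addrC.
Qed.

Lemma lnd0 : lnd 0 = 0.
Proof. by rewrite /lnd; have := flow_const 0; rewrite !rmorph0 => ->; rewrite coef0. Qed.

(** Compare the coefficients of s in the two expansions of the action of
    [phi (s + t)]: this is where the group law enters. *)
Lemma flow_coefS f i : lnd (flow f)`_i = (flow f)`_i.+1 *+ i.+1.
Proof.
suff E : \poly_(i < size (flow f)) lnd (flow f)`_i = (flow f)^`().
  have := congr1 (fun p : {poly R} => p`_i) E.
  rewrite coef_poly coef_deriv; case: ltnP => // si.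
  rewrite [(flow f)`_i]nth_default // => <-.
  exact: lnd0.
apply: family_at_ext => // s x.
pose p := map_poly (eval_at x) (flow f).
pose q := \sum_(i < size (flow f))
  (s ^+ i) *: map_poly (eval_at x) (flow (flow f)`_i).
have pq : p \Po ('X + s%:P) = q.
  apply: poly_ext_char0 => // t; rewrite horner_comp !hornerE.
  rewrite -[p.[_]]/(family_at (flow f) _ x) flowP addrC one_paramD -flowP /q.
  rewrite horner_sum /family_at (horner_coef_wide _ (size_poly _ _)).
  apply: eq_bigr => l _; rewrite hornerZ.
  rewrite -[(map_poly _ _).[t]]/(family_at (flow (flow f)`_l) t x) flowP.
  by rewrite coef_map mulrC.
have := congr1 (fun r : {poly k} => r`_1) pq; rewrite /q coef_sum.
rewrite (_ : (p \Po _)`_1 = p^`().[s]) => [|]; last first.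
  have -> : (p \Po ('X + s%:P))`_1 = (p \Po ('X + s%:P))^`()`_0.
    by rewrite coef_deriv.
  rewrite -horner_coef0 deriv_comp derivD derivX derivC addr0 mulr1.
  by rewrite horner_comp !hornerE.
rewrite /family_at -deriv_map -/p => ->.
rewrite (horner_coef_wide (n := size (flow f))); last first.
  by apply: leq_trans (size_poly _ _) _; exact: size_poly.
apply: eq_bigr => l _; rewrite coef_map coef_poly ltn_ord coefZ coef_map.
by rewrite mulrC.
Qed.

(** [flow phi f] is exp (t D) f with D = [lnd phi]. *)
Lemma iter_lnd f j : iter j lnd f = (flow f)`_j *+ j`!.
Proof.
have [_ lD _] := lnd_derivation; elim: j => [|j IH] /=.
  by rewrite flow_coef0.
rewrite IH factS mulrnA -flow_coefS; elim: (j`!) => [|i IHi].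
  by rewrite !mulr0n lnd0.
by rewrite !mulrSr lD IHi.
Qed.

Lemma lnd_nilpotent f : exists N, forall j, (N <= j)%N -> iter j lnd f = 0.
Proof.
by exists (size (flow f)) => j sj; rewrite iter_lnd nth_default // mul0rn.
Qed.

End OneParameter.

Section Conjugation.
Variables (k : closedFieldType) (n : nat) (X : irr_affine_variety k n).
Local Notation R := (regular_function X).
Hypothesis char0 : [pchar k] =i pred0.

Section Conjugate.
Variables (g : automorphism X) (phi : one_param X).

Definition conjugate t : automorphism X := (g^-1 * phi t * g)%g.

Definition conjugate_flow f := map_poly (pullback g) (flow phi (pullback g^-1%g f)).

Lemma conjugate_flowP f t x :
  family_at (conjugate_flow f) t x = eval_at (conjugate t x) f.
Proof.
rewrite /family_at /conjugate_flow -map_poly_comp.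
rewrite (_ : map_poly _ _ = map_poly (eval_at (g x)) (flow phi (pullback g^-1%g f))).
  by rewrite -[LHS]/(family_at _ _ _) flowP.
exact: eq_map_poly.
Qed.

Fact conjugate_inj : injective conjugate.
Proof. by move=> s t /mulIg/mulgI/one_param_inj. Qed.

Fact conjugate_morph : {morph conjugate : s t / s + t >-> (s * t)%g}.
Proof.
by move=> s t; rewrite /conjugate one_param_morph !mulgA mulgK.
Qed.

Fact conjugate_algebraic : algebraic_action conjugate.
Proof.
apply/algebraic_actionP => f; exists (conjugate_flow f) => t x.
by rewrite conjugate_flowP.
Qed.

Definition conjugate_one_param :=
  OneParam conjugate_inj conjugate_morph conjugate_algebraic.

Lemma lnd_conjugate f :
  lnd conjugate_one_param f = pullback g (lnd phi (pullback g^-1%g f)).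
Proof.
rewrite /lnd (@flow_unique _ _ _ _ char0 f (conjugate_flow f)) ?coef_map //.
exact: conjugate_flowP.
Qed.

End Conjugate.

Lemma derivation_along_scale (d : R -> R) c f :
  derivation_along (regular_const X) idfun d ->
  d (regular_const X c * f) = regular_const X c * d f.
Proof. by case=> dC _ dM; rewrite dM dC mul0r add0r. Qed.

Lemma derivation_along_sum (d : R -> R) (I : Type) (s : seq I) (F : I -> R) :
  derivation_along (regular_const X) idfun d ->
  d (\sum_(i <- s) F i) = \sum_(i <- s) d (F i).
Proof.
case=> dC dD _; elim: s => [|i s IH]; rewrite ?big_nil ?big_cons ?dD ?IH //.
by have := dC 0; rewrite rmorph0.
Qed.

(** With psi_t = exp (t E) and D = [lnd phi], the derivation of the conjugate is
    exp (t E) D exp (- t E), whose expansion starts with D + t (E D - D E). *)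
Lemma conjugate_family (psi phi : one_param X) f :
  exists E : {poly R}, E`_1 = lnd psi (lnd phi f) - lnd phi (lnd psi f) /\
    forall t x,
      family_at E t x = eval_at x (lnd (conjugate_one_param (psi t) phi) f).
Proof.
have dphi := lnd_derivation phi char0.
pose c j := (flow psi f)`_j; pose N := (size (flow psi f)).+2.
(* expand exp (- t E) f in powers of t, then apply D and exp (t E) termwise *)
exists (\sum_(j < N) (- 'X) ^+ j * flow psi (lnd phi (c j))); split.
  rewrite /N 2!big_ord_recl coefD expr0 mul1r -[(flow _ _)`_1]/(lnd _ _).
  rewrite {1}/c flow_coef0 // coefD expr1 mulNr coefN coefXM /= flow_coef0 //.
  rewrite coef_sum big1 ?addr0 // => j _.
  (* the terms of index at least 2 are divisible by 'X^2 *)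
  by rewrite [X in X * _]/= 2!exprS mulrA mulrNN -!mulrA !coefXM.
move=> t x; rewrite lnd_conjugate eval_pullback.
have -> : pullback (psi t)^-1%g f = \sum_(j < N) regular_const X ((- t) ^+ j) * c j.
  apply: regular_function_ext => y; rewrite -!/(eval_at y _) eval_pullback.
  have -> : (psi t)^-1%g = psi (- t).
    apply: mulg1_eq; rewrite -one_param_morph subrr.
    by apply: automorphism_ext => z; rewrite one_param0.
  rewrite -flowP /family_at (horner_coef_wide (n := N)); last first.
    by apply: leq_trans (size_poly _ _) _; rewrite /N ltnW.
  rewrite rmorph_sum; apply: eq_bigr => j _.
  by rewrite rmorphM /= coef_map mulrC.
rewrite derivation_along_sum // rmorph_sum /family_at rmorph_sum /= horner_sum.
apply: eq_bigr => j _; rewrite derivation_along_scale // !rmorphM /= hornerM.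
rewrite -[X in _ * X]/(family_at _ _ _) flowP; congr (_ * _).
by rewrite rmorphXn /= rmorphN /= map_polyX !hornerE.
Qed.
End Conjugation.

(** * A maximal independent family of velocity fields *)

Section VelocitySpan.
Variables (k : closedFieldType) (n : nat) (X : irr_affine_variety k n).
Local Notation R := (regular_function X).
Hypothesis char0 : [pchar k] =i pred0.

Lemma derivation_coordinates (p : {mpoly k[n]}) (d : R -> R) :
  derivation_along (regular_const X) idfun d ->
  d (mmap (regular_const X) (coordinate X) p) =
    \sum_i mmap (regular_const X) (coordinate X) p^`M(i) * d (coordinate X i).
Proof. exact: chain_rule. Qed.

Definition velocity_span r (D : 'I_r -> R -> R) (d : R -> R) :=
  exists2 g, g != 0 & exists b : 'I_r -> R, forall u, g * d u = \sum_j b j * D j u.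

Lemma velocity_span_coordinates r (D : 'I_r -> R -> R) (d : R -> R) g b :
  (forall j, derivation_along (regular_const X) idfun (D j)) ->
  derivation_along (regular_const X) idfun d -> g != 0 ->
  (forall i, g * d (coordinate X i) = \sum_j b j * D j (coordinate X i)) ->
  velocity_span D d.
Proof.
move=> derD derd g0 bE; exists g => //; exists b => u.
have [p ->] := regular_mmap u; rewrite derivation_coordinates // mulr_sumr.
under eq_bigr do rewrite mulrCA bE mulr_sumr.
rewrite exchange_big; apply: eq_bigr => j _ /=.
by rewrite derivation_coordinates // mulr_sumr; apply: eq_bigr => i _; rewrite mulrCA.
Qed.

(** Independent families have at most n members because each derivation is
    determined by its values on the n coordinates.  Adding any other derivation
    to a maximal family creates a relation, in which the coefficient of the new
    one is nonzero. *)
Lemma maximal_velocities : exists (r : nat) (Phi : 'I_r -> one_param X),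
  free_rows (fun j i => lnd (Phi j) (coordinate X i)) /\
  forall phi : one_param X, velocity_span (fun j => lnd (Phi j)) (lnd phi).
Proof.
pose P r := `[< exists Phi : 'I_r -> one_param X,
  free_rows (fun j i => lnd (Phi j) (coordinate X i)) >].
have exP : exists r, P r.
  exists 0%N; apply/asboolP.
  exists (fun i : 'I_0 => False_rect _ (notF (ltn_ord i))).
  by move=> b _ [].
have leP r : P r -> (r <= n)%N by move=> /asboolP[Phi /free_rows_leq].
case: (ex_maxnP exP leP) => r /asboolP[Phi freePhi] maxr; exists r, Phi.
split=> // phi.
pose Phi' (j : 'I_r.+1) := if unlift ord_max j is Some j' then Phi j' else phi.
have notfree : ~ free_rows (fun j i => lnd (Phi' j) (coordinate X i)).
  move=> free'; suff /maxr : P r.+1 by rewrite ltnn.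
  by apply/asboolP; exists Phi'.
have [b [bE [j0 bj0]]] : exists b : 'I_r.+1 -> R,
    (forall i, \sum_j b j * lnd (Phi' j) (coordinate X i) = 0) /\ exists j, b j != 0.
  apply: contrapT => nb; apply: notfree => b bE j; apply/eqP/negPn/negP => bj.
  by apply: nb; exists b; split=> //; exists j.
have split_sum i : \sum_j b (lift ord_max j) * lnd (Phi j) (coordinate X i) +
    b ord_max * lnd phi (coordinate X i) = 0.
  rewrite -[RHS](bE i) big_ord_recr /= /Phi' unlift_none; congr (_ + _).
  apply: eq_bigr => j _.
  have -> : widen_ord (leqnSn r) j = lift ord_max j.
    by apply: val_inj; rewrite /= /bump leqNgt ltn_ord.
  by rewrite liftK.
have bmax : b ord_max != 0.
  apply: contraNneq bj0 => b0; case: (unliftP ord_max j0) => [j|] ->; last exact/eqP.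
  apply/eqP; apply: (freePhi (fun j => b (lift ord_max j))) => i.
  by have := split_sum i; rewrite b0 mul0r addr0.
apply: (@velocity_span_coordinates _ _ _ (b ord_max)
          (fun j => - b (lift ord_max j))) => [j|||i] //.
- exact: lnd_derivation.
- exact: lnd_derivation.
apply/eqP; rewrite -subr_eq0 -sumrN; apply/eqP; rewrite -[RHS](split_sum i) addrC.
by congr (_ + _); apply: eq_bigr => j _; rewrite mulNr opprK.
Qed.

(** All conjugates of [phi] by elements of [psi] lie in the span.  They form a
    polynomial family in the parameter, so each coefficient of this family lies
    in the span as well, and the linear one is the bracket. *)
Lemma bracket_velocities r (D : 'I_r -> R -> R) (phi psi : one_param X) :
  (forall j, derivation_along (regular_const X) idfun (D j)) ->
  (forall phi : one_param X, velocity_span D (lnd phi)) ->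
  velocity_span D (fun u => lnd psi (lnd phi u) - lnd phi (lnd psi u)).
Proof.
move=> derD spanD.
have [dC dD dM] := lnd_derivation psi char0.
have [eC eD eM] := lnd_derivation phi char0.
have /choice[E EE] := fun i => conjugate_family char0 psi phi (coordinate X i).
have [|g g0 [b bE]] := @row_of_annihilator R r n (fun j i => D j (coordinate X i))
    (fun i => lnd psi (lnd phi (coordinate X i)) - lnd phi (lnd psi (coordinate X i))).
  move=> c cD; pose F : {poly R} := \sum_i E i * (c i)%:P.
  have -> : \sum_i (lnd psi (lnd phi (coordinate X i))
      - lnd phi (lnd psi (coordinate X i))) * c i = F`_1.
    by rewrite coef_sum; apply: eq_bigr => i _; rewrite coefMC; have [-> _] := EE i.
  suff -> : F = 0 by rewrite coef0.
  apply: family_at_ext => // t x.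
  rewrite /family_at rmorph0 horner0 rmorph_sum /= horner_sum.
  pose conj := conjugate_one_param (psi t) phi.
  have [g g0 [b bE]] := spanD conj.
  rewrite -[RHS](_ : eval_at x (\sum_i lnd conj (coordinate X i) * c i) = 0).
    rewrite rmorph_sum; apply: eq_bigr => i _.
    rewrite !rmorphM /= hornerM map_polyC hornerC; congr (_ * _).
    by have [_ EEi] := EE i; rewrite -EEi.
  apply/eqP; rewrite (_ : \sum_i _ = 0) ?rmorph0 //.
  apply: (mulfI g0); rewrite mulr0 mulr_sumr.
  under eq_bigr do rewrite mulrA bE mulr_suml.
  rewrite exchange_big big1 //= => j _.
  under eq_bigr do rewrite -mulrA.
  by rewrite -mulr_sumr cD mulr0.
apply: (velocity_span_coordinates derD _ g0 bE); split.
- by move=> a; rewrite eC dC !lnd0 // subrr.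
- by move=> u v; rewrite eD !dD !eD opprD addrACA.
- by move=> u v /=; rewrite eM dM !eD !dD !eM !dM /=; ring.
Qed.

End VelocitySpan.

(** * Rational invariants and the transcendence degree *)

Section RationalInvariants.
Variables (k : closedFieldType) (n : nat) (X : irr_affine_variety k n).
Local Notation R := (regular_function X).

Lemma rational_pullback_fixed g (a b : R) : b != 0 ->
  rational_pullback g (a%:F / b%:F) = a%:F / b%:F <->
  pullback g a * b = a * pullback g b.
Proof.
move=> b0; rewrite rational_pullbackE //.
have gb0 := pullback_neq0 g b0.
have -> : ((pullback g a)%:F / (pullback g b)%:F = a%:F / b%:F) <->
    ((pullback g a)%:F / (pullback g b)%:F == a%:F / b%:F).
  by split=> [->|/eqP].
by rewrite eqr_div ?tofrac_eq0 // -!rmorphM tofrac_eq; split=> [/eqP|->].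
Qed.

(** Invariance of a fraction is inherited by products and inverses, so it is
    enough to have it on the generators of the group. *)
Lemma FML_fraction (a b : R) : b != 0 ->
  (forall (phi : one_param X) t, pullback (phi t) a * b = a * pullback (phi t) b) ->
  FML (a%:F / b%:F).
Proof.
move=> b0 inv g gS; apply/rational_pullback_fixed => //.
pose Inv : set (automorphism X) := [set g | pullback g a * b = a * pullback g b]%classic.
suff : Inv g by [].
apply: gS.
  split=> [|g1 g2 /= h1 h2].
    by congr (_ * _); apply: regular_function_ext.
  have b2 := pullback_neq0 g2 b0; apply: (mulfI b2).
  apply: regular_function_ext => x.
  pose y := (g1^-1 * g2)%g x; rewrite -!/(eval_at x _) !rmorphM /= !eval_pullback.
  rewrite -/y; have g1y : g1 y = g2 x by rewrite /y /= aut_invK.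
  have := congr1 (eval_at y) h1; have := congr1 (eval_at x) h2.
  rewrite !rmorphM /= !eval_pullback g1y => e2 e1.
  have -> (b' ay bx : k) : b' * (ay * bx) = ay * b' * bx by ring.
  rewrite -e1 mulrAC e2; ring.
move=> _ [H /one_paramP[phi ->] [t _ <-]]; exact: inv.
Qed.

Hypothesis char0 : [pchar k] =i pred0.

Lemma regular_mulrn_eq0 (f : R) m : f *+ m.+1 = 0 -> f = 0.
Proof.
move=> fm; apply: regular_function_ext => x.
have /eqP := congr1 (eval_at x) fm; rewrite rmorphMn rmorph0 -mulr_natr mulf_eq0.
by have /pcharf0P -> := char0; rewrite orbF => /eqP.
Qed.

(** If D kills a/b then D^j a / b = (a/b) (D^j b / b) for all j; summing the
    exponential series gives invariance under the flow. *)
Lemma lnd_constant_invariant (phi : one_param X) (a b : R) t : b != 0 ->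
  lnd phi a * b = a * lnd phi b -> pullback (phi t) a * b = a * pullback (phi t) b.
Proof.
move=> b0 Dab; have [dC dD dM] := lnd_derivation phi char0.
have iterD j : iter j (lnd phi) a * b = a * iter j (lnd phi) b.
  elim: j => //= j IH; have := congr1 (lnd phi) IH; rewrite !dM /= => IH'.
  have E : iter j (lnd phi) a * lnd phi b = lnd phi a * iter j (lnd phi) b.
    apply: (mulIf b0); rewrite mulrAC IH [a * _]mulrC -mulrA -Dab.
    by rewrite mulrC -mulrA [b * _]mulrC mulrA.
  by move: IH'; rewrite E addrC => /addrI.
suff E : flow phi a * b%:P = a%:P * flow phi b.
  apply: regular_function_ext => x; rewrite -!/(eval_at x _) !rmorphM /=.
  have := congr1 (fun p => family_at p t x) E; rewrite /family_at !rmorphM /=.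
  rewrite !hornerM !map_polyC !hornerC -!/(family_at _ _ _) !flowP.
  by rewrite !eval_pullback.
apply/polyP => j; rewrite coefMC coefCM; apply/eqP; rewrite -subr_eq0; apply/eqP.
have := iterD j; rewrite !iter_lnd // => /eqP; rewrite -subr_eq0 mulrnAl mulrnAr.
by rewrite -mulrnBl -(prednK (fact_gt0 j)) => /eqP/regular_mulrn_eq0.
Qed.

(** In a nonzero solution a of minimal support, a_1 D(a_i) - D(a_1) a_i is again
    a solution for each derivation D, and it vanishes at the index 1, so it is
    zero.  Thus the ratios a_i / a_1 are killed by all derivations and are
    constants, which the empty word turns into a linear relation between the
    m_i over k. *)
Lemma wronskian (I : finType) (m a : I -> R) : FML_trivial X ->
  (forall lam : I -> k, \sum_i regular_const X (lam i) * m i = 0 ->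
     forall i, lam i = 0) ->
  (forall w : seq (one_param X), \sum_i a i * opword (@lnd _ _ X) w (m i) = 0) ->
  forall i, a i = 0.
Proof.
move=> FMLk indep; have [N] := ubnP #|[pred i | a i != 0]|.
elim: N a => // N IH a; rewrite ltnS => aN aw i1; apply/eqP/negPn/negP => ai1.
have prop (phi : one_param X) i : a i1 * lnd phi (a i) - lnd phi (a i1) * a i = 0.
  apply: (IH (fun i => a i1 * lnd phi (a i) - lnd phi (a i1) * a i)) => [|w].
    apply: leq_trans aN; apply: proper_card; apply/properP; split.
      apply/fintype.subsetP => l; rewrite !inE; apply: contra_neq => ->.
      by rewrite lnd0 // !mulr0 subrr.
    by exists i1; rewrite !inE // mulrC subrr eqxx.
  have [_ dD dM] := lnd_derivation phi char0.
  transitivity (a i1 * (lnd phi (\sum_i a i * opword (@lnd _ _ X) w (m i))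
      - \sum_i a i * opword (@lnd _ _ X) (phi :: w) (m i))
      - lnd phi (a i1) * \sum_i a i * opword (@lnd _ _ X) w (m i)).
    rewrite (derivation_along_sum _ _ (lnd_derivation phi char0)).
    rewrite -sumrB !mulr_sumr -sumrB.
    by apply: eq_bigr => l _; rewrite dM /=; ring.
  by rewrite !aw lnd0 // subrr !mulr0 subrr.
have /choice[lam lamE] : forall i, exists c, a i = regular_const X c * a i1.
  move=> i; have fi : FML ((a i)%:F / (a i1)%:F).
    apply: FML_fraction => // phi t; apply: lnd_constant_invariant => //.
    by apply/eqP; rewrite -subr_eq0 mulrC [a i * _]mulrC; apply/eqP/prop.
  rewrite FMLk in fi; have [c _ ce] := fi; exists c.
  move: ce => /(congr1 (fun z => z * (a i1)%:F)); rewrite divfK ?tofrac_eq0 //.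
  move/eqP; rewrite /const_rational -rmorphM tofrac_eq => /eqP/esym.
  exact.
have lam1 : lam i1 = 1.
  have /eqP := lamE i1; rewrite -{1}[a i1]mul1r (inj_eq (mulIf ai1)) => /eqP e.
  by apply: (fmorph_inj (regular_const X)); rewrite rmorph1; exact: esym e.
have /indep/(_ i1) : \sum_i regular_const X (lam i) * m i = 0.
  have := aw [::]; rewrite /= => am; apply: (mulfI ai1).
  rewrite mulr0 mulr_sumr -[RHS]am; apply: eq_bigr => i _.
  by rewrite [a i]lamE mulrA [a i1 * _]mulrC.
by rewrite lam1 => /eqP; rewrite oner_eq0.
Qed.

Lemma mmap_const_rational e (s : 'I_e -> {fraction R}) (P : {mpoly k[e]}) :
  mmap (@const_rational _ _ X) s P =
  mmap (@FracField.tofrac R \o regular_const X) s P.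
Proof. by []. Qed.

(** The transcendence degree is at most the number of independent velocity
    fields.  The linear relations of [too_many_monomials] hold for sorted words
    in the D_i, hence for all words, against [wronskian]. *)
Lemma independent_leq r (Phi : 'I_r -> one_param X) e
    (s : 'I_e -> {fraction R}) : FML_trivial X ->
  (forall phi : one_param X, velocity_span (fun j => lnd (Phi j)) (lnd phi)) ->
  algebraically_independent s -> (e <= r)%N.
Proof.
move=> FMLk spanPhi indep; rewrite leqNgt; apply/negP => re.
have derPhi j : derivation_along (regular_const X) idfun (lnd (Phi j)).
  exact: lnd_derivation.
have derivPhi j : derivation (lnd (Phi j)) by have [] := derPhi j.
have [b b0 [v vE]] := common_denominator s.
have nilPhi j := lnd_nilpotent (Phi j) char0.
have [N [a [beta0 a0] aE]] := too_many_monomials derivPhi nilPhi b v re.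
move: a0; rewrite (wronskian (m := homogenized b v) FMLk) ?eqxx //.
  move=> lam lamE beta1.
  pose mon (beta : {ffun 'I_e -> 'I_N}) := [multinom (beta j : nat) | j < e].
  have mon_inj : injective mon.
    move=> beta beta' /mnmP E; apply/ffunP => j; apply: val_inj.
    by have := E j; rewrite !mnmE.
  pose P : {mpoly k[e]} := \sum_beta lam beta *: 'X_[mon beta].
  have P0 : P = 0.
    apply: indep; rewrite mmap_const_rational raddf_sum /=.
    have bF : b%:F != 0 by rewrite tofrac_eq0.
    apply: (mulfI (expf_neq0 (e * N) bF)); rewrite mulr0 mulr_sumr.
    rewrite -[RHS](rmorph0 (@FracField.tofrac R)) -lamE rmorph_sum /=.
    apply: eq_bigr => beta _; rewrite mmapZ mmapX /= rmorphM /= mulrCA.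
    congr (_ * _); rewrite /homogenized rmorphM rmorphXn rmorph_prod /=.
    have sb : (\sum_j beta j <= e * N)%N.
      rewrite -[X in (_ <= X * _)%N]card_ord -sum_nat_const.
      by apply: leq_sum => j _; exact: ltnW.
    rewrite -{1}(subnK sb) exprD -mulrA; congr (_ * _).
    rewrite -prodrXr -big_split /=; apply: eq_bigr => j _.
    by rewrite mnmE -exprMn vE rmorphXn.
  have : P@_(mon beta1) = 0 by rewrite P0 mcoeff0.
  rewrite /P raddf_sum /= (bigD1 beta1) //=.
  rewrite mcoeffZ mcoeffX eqxx mulr1 big1 ?addr0 // => beta nb.
  by rewrite mcoeffZ mcoeffX (inj_eq mon_inj) (negPf nb) mulr0.
move=> w.
have bracketPhi i j := bracket_velocities char0 (Phi j) (Phi i) derPhi spanPhi.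
have := word_of_span derivPhi bracketPhi w spanPhi.
elim=> [Q [u us ->]||Q1 Q2 _ h1 _ h2|c Q _ h|g Q g0 _ h].
- exact: aE.
- by rewrite big1 // => beta _; rewrite mulr0.
- by under eq_bigr do rewrite mulrDr; rewrite big_split /= h1 h2 addr0.
- by under eq_bigr do rewrite mulrCA; rewrite -mulr_sumr h mulr0.
- by apply: (mulfI g0); rewrite mulr0 mulr_sumr; under eq_bigr do rewrite mulrCA.
Qed.

End RationalInvariants.

(** * Tangent spaces at general points *)

Section TangentSpaces.
Variables (k : closedFieldType) (n : nat).

Lemma tangent_space_sub (V W : set 'rV[k]_n) x :
  (V `<=` W -> tangent_space V x `<=` tangent_space W x)%classic.
Proof. by move=> VW v vV p pW; apply: vV => y /VW; exact: pW. Qed.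

Lemma tangent_derivation (x v : 'rV[k]_n) :
  derivation_along (@mpolyC n k) (meval (x 0))
    (fun p => \sum_(i < n) (p^`M(i)).@[x 0] * v 0 i).
Proof.
split=> [c|p q|p q].
- by rewrite big1 // => i _; rewrite mderivC meval0 mul0r.
- by rewrite -big_split; apply: eq_bigr => i _; rewrite mderivD mevalD mulrDl.
- rewrite mulr_suml mulr_sumr -big_split; apply: eq_bigr => i _ /=.
  by rewrite mderivM mevalD !mevalM; ring.
Qed.

Lemma tangent_spaceB (V : set 'rV[k]_n) x u v :
  tangent_space V x u -> tangent_space V x v -> tangent_space V x (u - v).
Proof.
move=> uV vV p pV; under eq_bigr do rewrite !mxE mulrBr.
by rewrite sumrB uV // vV // subrr.
Qed.

Lemma tangent_space_sum (V : set 'rV[k]_n) x (I : finType) (c : I -> k)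
    (v : I -> 'rV[k]_n) :
  (forall i, tangent_space V x (v i)) ->
  tangent_space V x (\sum_i c i *: v i).
Proof.
move=> vV p pV; under eq_bigr do rewrite summxE mulr_sumr.
rewrite exchange_big big1 //= => i _.
under eq_bigr do rewrite mxE mulrCA.
by rewrite -mulr_sumr vV // mulr0.
Qed.

End TangentSpaces.

Section TangentVectors.
Variables (k : closedFieldType) (n : nat) (X : irr_affine_variety k n).
Local Notation R := (regular_function X).
Hypothesis char0 : [pchar k] =i pred0.

Lemma mmap_tofrac e (u : 'I_e -> R) (P : {mpoly k[e]}) :
  mmap (@const_rational _ _ X) (fun j => (u j)%:F) P =
  (mmap (regular_const X) u P)%:F.
Proof.
rewrite mmap_const_rational; elim/mpoly_ring_ind: P => [c|i|p q hp hq|p q hp hq].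
- by rewrite !mmapC.
- by rewrite !mmapX !mmap1U.
- by rewrite !rmorphD /= hp hq.
- by rewrite !rmorphM /= hp hq.
Qed.

Definition velocity (phi : one_param X) (x : X) : 'rV[k]_n :=
  \row_i eval_at x (lnd phi (coordinate X i)).

Lemma orbit_sub (H : set (automorphism X)) x :
  (val @` orbit_of H x `<=` X)%classic.
Proof. by move=> _ [y _ <-]; exact/set_mem/valP. Qed.

Lemma eval_lnd_mpoly (phi : one_param X) (x : X) (p : {mpoly k[n]}) :
  eval_at x (lnd phi (mmap (regular_const X) (coordinate X) p)) =
  \sum_(i < n) (p^`M(i)).@[val x 0] * velocity phi x 0 i.
Proof.
rewrite derivation_coordinates; last exact: lnd_derivation.
rewrite rmorph_sum; apply: eq_bigr => i _.
rewrite rmorphM /= eval_at_mmap mxE; congr (_ * _).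
by apply: meval_eq => j; rewrite eval_at_coordinate.
Qed.

(** A function vanishing on the orbit has zero flow at x, in particular a zero
    linear coefficient. *)
Lemma velocity_tangent (phi : one_param X) (x : X) :
  tangent_space (val @` orbit_of (range phi) x)%classic (val x) (velocity phi x).
Proof.
move=> p pO; rewrite -eval_lnd_mpoly /lnd -coef_map.
set f := mmap _ _ _; suff -> : map_poly (eval_at x) (flow phi f) = 0 by rewrite coef0.
apply: poly_eq0_char0 => // t; rewrite -[LHS]/(family_at _ _ _) flowP /f eval_at_mmap.
rewrite -[RHS](pO (val (phi t x))); last first.
  by exists (phi t x) => //; exists (phi t) => //; exists t.
by apply: meval_eq => i; rewrite eval_at_coordinate.
Qed.

(** Differentiating the relation along v gives an equation in which v_i has a
    nonzero coefficient and the other terms involve only the coordinates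
    selected by f. *)
Lemma tangent_relation r (f : 'I_r -> 'I_n) (i : 'I_n) (P : {mpoly k[r.+1]})
    (x : X) (v : 'rV[k]_n) :
  let u := extend_fun (fun j => coordinate X (f j)) (coordinate X i) in
  mmap (regular_const X) u P = 0 ->
  eval_at x (mmap (regular_const X) u P^`M(ord_max)) != 0 ->
  tangent_space X (val x) v -> (forall j, v 0 (f j) = 0) -> v 0 i = 0.
Proof.
move=> u Pu dPu vT vf.
pose g := extend_fun f i.
pose q Q : {mpoly k[n]} := mmap (@mpolyC n k) (fun j => 'X_(g j)) Q.
have qE Q (y : X) : (q Q).@[val y 0] = eval_at y (mmap (regular_const X) u Q).
  rewrite eval_at_mmap /q; elim/mpoly_ring_ind: Q => [c|j|p p' hp hp'|p p' hp hp'].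
  - by rewrite mmapC !mevalC.
  - rewrite mmapX mmap1U !mevalXU /u /g /extend_fun.
    by case: unlift => [j'|]; rewrite eval_at_coordinate.
  - by rewrite !rmorphD /= hp hp'.
  - by rewrite !rmorphM /= hp hp'.
have /vT : vanishing_ideal X (q P).
  by move=> y yX; rewrite (qE P (SigSub (mem_set yX))) Pu.
rewrite (chain_rule _ _ (tangent_derivation (val x) v)).
rewrite (bigD1 ord_max) //= [X in _ + X]big1 => [|j jm].
  rewrite addr0 -[X in X * _]/((q P^`M(ord_max)).@[val x 0]) qE => /eqP.
  rewrite mulf_eq0 (negPf dPu) /= /g extend_fun_max.
  rewrite (bigD1 i) //= mderivXU eqxx rmorph1 mul1r big1 => [|l li].
    by rewrite addr0 => /eqP.
  by rewrite mderivXU eq_sym (negPf li) rmorph0 mul0r.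
case: (unliftP ord_max j) jm => [j' ->|->]; last by rewrite eqxx.
move=> _; rewrite /g extend_fun_lift [X in _ * X]big1 ?mulr0 // => l _.
rewrite mderivXU; case: eqP => [<-|_]; first by rewrite vf mulr0.
by rewrite rmorph0 mul0r.
Qed.

Lemma minor_independent r (D : 'I_r -> R -> R) (u : 'I_r -> R) :
  (forall i, derivation_along (regular_const X) idfun (D i)) ->
  \det (\matrix_(i, j) D i (u j)) != 0 ->
  algebraically_independent (fun j => (u j)%:F).
Proof.
move=> derD detD P; rewrite mmap_tofrac => /eqP; rewrite tofrac_eq0 => /eqP Pu.
apply: (jacobian_independent (S := predT) char0 derD _ _ Pu) => // a _ aE.
apply: (det_neq0_free detD) => i; rewrite -[RHS](aE i); apply: eq_bigr => j _.
by rewrite mxE mulrC.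
Qed.

Lemma minor_separable r (D : 'I_r -> R -> R) (u : 'I_r -> R) z :
  (forall i, derivation_along (regular_const X) idfun (D i)) ->
  \det (\matrix_(i, j) D i (u j)) != 0 ->
  ~ algebraically_independent (fun j => (extend_fun u z j)%:F) ->
  exists2 P : {mpoly k[r.+1]}, mmap (regular_const X) (extend_fun u z) P = 0
    & mmap (regular_const X) (extend_fun u z) P^`M(ord_max) != 0.
Proof.
move=> derD detD dep; apply: (separable_relation char0 derD) => [a am aE|].
  exact: minor_extend detD am aE.
apply: contrapT => nP; apply: dep => P; rewrite mmap_tofrac => /eqP.
rewrite tofrac_eq0 => /eqP Pu; apply/eqP/negPn/negP => P0; apply: nP.
by exists P.
Qed.

(** At a point where finitely many nonzero functions do not vanish, a tangent
    vector is determined by r of its coordinates, and r velocities have an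
    invertible matrix in these coordinates. *)
Theorem FML_flexible : FML_trivial X -> exists x : X, flexible_point x.
Proof.
move=> FMLk; have [r [Phi [freePhi spanPhi]]] := maximal_velocities X char0.
have derPhi j : derivation_along (regular_const X) idfun (lnd (Phi j)).
  exact: lnd_derivation.
have [f detf] := free_rows_minor freePhi.
have leq_r e (s : 'I_e -> {fraction R}) : algebraically_independent s -> (e <= r)%N.
  exact: independent_leq.
have dimX : variety_dim X r.
  split.
    exists (fun j => (coordinate X (f j))%:F).
    exact: (minor_independent (u := fun j => coordinate X (f j)) derPhi detf).
  by move=> s /leq_r; rewrite ltnn.
pose u i := extend_fun (fun j => coordinate X (f j)) (coordinate X i).
have /choice[P /all_and2[P0 dP]] : forall i, exists P : {mpoly k[r.+1]},
    mmap (regular_const X) (u i) P = 0 /\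
    mmap (regular_const X) (u i) P^`M(ord_max) != 0.
  move=> i.
  have [|P ? ?] := minor_separable (u := fun j => coordinate X (f j))
      (z := coordinate X i) derPhi detf.
    by move/leq_r; rewrite ltnn.
  by exists P.
have dPprod : \prod_i mmap (regular_const X) (u i) (P i)^`M(ord_max) != 0.
  by apply/prodf_neq0 => i _.
have [x] := neq0_point (mulf_neq0 detf dPprod).
rewrite rmorphM rmorph_prod /= mulf_eq0 negb_or.
move=> /andP[detx /prodf_neq0 dPx].
have inj v : tangent_space X (val x) v -> (forall j, v 0 (f j) = 0) -> v = 0.
  move=> vT vf; apply/rowP => i; rewrite [RHS]mxE.
  exact: (tangent_relation (P0 i) (dPx i isT) vT vf).
pose V := [tuple velocity (Phi j) x | j < r].
have Vorb j : tangent_space (val @` orbit_of (range (Phi j)) x)%classic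
    (val x) (velocity (Phi j) x).
  exact: velocity_tangent.
have VT j : tangent_space X (val x) (velocity (Phi j) x).
  by apply: tangent_space_sub (Vorb j); exact: orbit_sub.
pose N : 'M[k]_r := \matrix_(i, j) velocity (Phi i) x 0 (f j).
have NU : N \in unitmx.
  rewrite unitmxE unitfE; move: detx; rewrite -det_map_mx.
  by congr (\det _ != 0); apply/matrixP => i j; rewrite !mxE.
have TV v : tangent_space X (val x) v -> v \in <<V>>%VS.
  move=> vT; pose c := (\row_j v 0 (f j)) *m invmx N.
  have -> : v = \sum_j c 0 j *: velocity (Phi j) x.
    apply/eqP; rewrite -subr_eq0; apply/eqP/inj.
      by apply: tangent_spaceB => //; exact: tangent_space_sum.
    move=> l; rewrite !mxE summxE; apply/eqP; rewrite subr_eq0; apply/eqP.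
    have /rowP/(_ l) : c *m N = \row_j v 0 (f j) by rewrite mulmxKV.
    rewrite !mxE => <-; apply: eq_bigr => j _; by rewrite !mxE.
  apply: memv_suml => j _; apply: memvZ; apply: memv_span.
  by apply/tnthP; exists j; rewrite tnth_mktuple.
have VfreeU : free V.
  apply/freeP => c cV j; have : \row_i c i *m N = 0.
    apply/rowP => l; rewrite !mxE; have /rowP/(_ (f l)) := cV.
    rewrite summxE !mxE => cVl; rewrite -[RHS]cVl; apply: eq_bigr => i _.
    by rewrite -tnth_nth tnth_mktuple !mxE.
  move/(congr1 (fun v => v *m invmx N)); rewrite mulmxK // mul0mx.
  by move/rowP/(_ j); rewrite !mxE.
have VsubT v : v \in <<V>>%VS -> tangent_space X (val x) v.
  move=> /coord_span ->; apply: tangent_space_sum => j.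
  by rewrite -tnth_nth tnth_mktuple.
exists x; split.
  exists r => //; exists <<V>>%VS; split.
    by apply/seteqP; split => v /=; [exact: TV|exact: VsubT].
  by rewrite (eqP VfreeU) size_tuple.
apply/seteqP; split=> v.
  move=> /TV vV; exists V => // w /tnthP[j ->]; rewrite tnth_mktuple.
  by exists (range (Phi j)) => //; apply/one_paramP; exists (Phi j).
move=> [s sT vs]; apply: VsubT; move: v vs; apply/subvP/span_subvP => w /sT[H _ wH].
by apply: TV; apply: tangent_space_sub wH; exact: orbit_sub.
Qed.

End TangentVectors.

(** * Open orbits *)

Section OpenOrbit.
Variables (k : closedFieldType) (n : nat) (X : irr_affine_variety k n).
Local Notation R := (regular_function X).

Lemma zariski_open_dense (U : set X) x0 (f : R) :
  zariski_open U -> U x0 -> (forall x, U x -> eval_at x f = 0) -> f = 0.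
Proof.
move=> [_ [S ->] ->] Ux0 fU.
have [p Sp px0] : exists2 p, S p & p.@[val x0 0] != 0.
  apply: contrapT => np; apply: Ux0 => p Sp; apply/eqP/negPn/negP => px0.
  by apply: np; exists p.
pose g := regular_of_mpoly X p.
have /eqP : f * g = 0.
  apply: regular_function_ext => x; rewrite -[LHS]/(eval_at x _) rmorphM /=.
  have [->|gx] := eqVneq (eval_at x g) 0; first by rewrite mulr0.
  by rewrite fU ?mul0r // => /(_ p Sp) px; move: gx; rewrite /eval_at /= px eqxx.
rewrite mulf_eq0 => /orP[/eqP//|/eqP g0]; move: px0.
by rewrite -[p.@[_]]/(eval_at x0 g) g0 rmorph0 eqxx.
Qed.

Lemma const_rational_FML c : FML (const_rational X c).
Proof.
move=> g _; have -> : const_rational X c = (regular_const X c)%:F / 1%:F.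
  by rewrite tofrac1 divr1.
apply/rational_pullback_fixed; first exact: oner_neq0.
by rewrite mulr1 rmorph1 mulr1; apply: regular_function_ext.
Qed.

Lemma SAut_subgroup : is_subgroup (@SAut k n X).
Proof.
split=> [H [H1 _] _|g h gS hS H HS SH]; first exact: H1.
by apply: (proj2 HS); [exact: gS|exact: hS].
Qed.

Lemma SAutV (g : automorphism X) : SAut g -> SAut g^-1%g.
Proof. by have [S1 SV] := SAut_subgroup => gS; rewrite -[g^-1%g]mulg1; exact: SV. Qed.

Lemma SAutM (g h : automorphism X) : SAut g -> SAut h -> SAut (g * h)%g.
Proof.
have [_ SV] := SAut_subgroup => gS hS; rewrite -[g]invgK; apply: SV => //.
exact: SAutV.
Qed.

Lemma SAut_one_param (phi : one_param X) t : SAut (phi t).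
Proof.
move=> H _; apply; exists (range phi); first by apply/one_paramP; exists phi.
by exists t.
Qed.

(** The constant value of an invariant a/b is its value at a point of the orbit
    where b does not vanish. *)
Theorem open_orbit_FML x : zariski_open (orbit_of (@SAut k n X) x) -> FML_trivial X.
Proof.
move=> openO; apply/seteqP; split=> [f fF|_ [c _ <-]]; last exact: const_rational_FML.
have [a [b [b0 fE]]] := fraction_quotient f.
have [y [g gS gy] by0] : exists2 y, orbit_of (@SAut k n X) x y & eval_at y b != 0.
  apply: contrapT => nb; case/eqP: b0.
  apply: (zariski_open_dense openO (x0 := x)).
    by exists 1%g => //; exact: (proj1 SAut_subgroup).
  move=> y yO; apply/eqP/negPn/negP => by0; apply: nb; exists y => //.
have [c cE] : exists c, c * eval_at y b = eval_at y a.
  by exists (eval_at y a / eval_at y b); rewrite divfK.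
exists c => //.
suff /eqP : a - regular_const X c * b = 0.
  rewrite fE subr_eq0 => /eqP ->; rewrite rmorphM /= mulfK ?tofrac_eq0 //.
apply: (zariski_open_dense openO (x0 := x)).
  by exists 1%g => //; exact: (proj1 SAut_subgroup).
move=> _ [h hS <-]; have hgS : SAut (h * g^-1)%g by apply: SAutM => //; exact: SAutV.
have hy : (h * g^-1)%g y = h x by rewrite -gy /= aut_funK.
have := fF _ hgS; rewrite fE => /(rational_pullback_fixed _ _ b0).
move/(congr1 (eval_at y)); rewrite !rmorphM /= !eval_pullback hy => e.
rewrite rmorphB rmorphM /= eval_at_const; apply/eqP; rewrite subr_eq0; apply/eqP.
by apply: (mulIf by0); rewrite e -cE mulrAC.
Qed.

End OpenOrbit.

(** * The tangent line of an orbit and the parametrization by a product of subgroups *)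

Section OrbitTangent.
Variables (k : closedFieldType) (n : nat) (X : irr_affine_variety k n).
Local Notation R := (regular_function X).
Hypothesis char0 : [pchar k] =i pred0.

Lemma flow_lnd (phi : one_param X) f : flow phi (lnd phi f) = (flow phi f)^`().
Proof.
apply/polyP => j; apply/eqP; rewrite -subr_eq0 coef_deriv; apply/eqP.
have := iter_lnd phi char0 (lnd phi f) j; rewrite -iterSr iter_lnd // factS mulrnA.
move/eqP; rewrite eq_sym -subr_eq0 -mulrnBl -(prednK (fact_gt0 j)) => /eqP.
exact: regular_mulrn_eq0.
Qed.

Lemma flow_iter_lnd (phi : one_param X) f m :
  flow phi (iter m (lnd phi) f) = (flow phi f)^`(m).
Proof. by elim: m => //= m IH; rewrite flow_lnd IH. Qed.

(** The orbit map is either constant or an isomorphism from the affine line onto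
    a closed curve.  In the second case the inverse is a polynomial p, obtained
    by differentiating a coordinate down to degree one; every coordinate is then
    a polynomial in p on the orbit, so a tangent vector v is determined by the
    derivative of p along v. *)
Lemma orbit_tangent_line (phi : one_param X) (x : X) (v : 'rV[k]_n) :
  tangent_space (val @` orbit_of (range phi) x)%classic (val x) v ->
  exists c, v = c *: velocity phi x.
Proof.
move=> vT.
pose c i := map_poly (eval_at x) (flow phi (coordinate X i)).
have cE i t : (c i).[t] = val (phi t x) 0 i.
  by rewrite -[LHS]/(family_at _ _ _) flowP eval_at_coordinate.
have vanish (p : {mpoly k[n]}) : (forall t, p.@[val (phi t x) 0] = 0) ->
    \sum_(i < n) (p^`M(i)).@[val x 0] * v 0 i = 0.
  by move=> p0; apply: vT => _ [_ [_ [t _ <-] <-] <-].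
pose dv (p : {mpoly k[n]}) := \sum_(i < n) (p^`M(i)).@[val x 0] * v 0 i.
have dV : derivation_along (@mpolyC n k) (meval (val x 0)) dv.
  exact: tangent_derivation.
have dvX i : dv 'X_i = v 0 i.
  rewrite /dv (bigD1 i) //= mderivXU eqxx rmorph1 mul1r big1 ?addr0 // => j ji.
  by rewrite mderivXU eq_sym (negPf ji) rmorph0 mul0r.
have [dC dD dM] := dV.
have dvN p q : dv (p - q) = dv p - dv q.
  rewrite -[q in LHS]mul1r -mulNr dD -mpolyC1 -mpolyCN dM dC mul0r /=.
  by rewrite mevalC add0r mulN1r.
have [const_orbit|] := boolP [forall i, size (c i) <= 1]%N.
  exists 0; apply/rowP => i; rewrite scale0r mxE -dvX.
  have := vanish ('X_i - (val x 0 i)%:MP); rewrite -/(dv _) dvN dC subr0; apply=> t.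
  have ct : (c i).[t] = (c i).[0].
    by rewrite (size1_polyC (forallP const_orbit i)) !hornerC.
  by rewrite mevalB mevalXU mevalC -cE ct cE one_param0 subrr.
rewrite negb_forall => /existsP[i0]; rewrite -ltnNge => size_c.
(* Differentiating the coordinate until it becomes an affine function of t
   shows that t itself is a regular function on the orbit. *)
have [tau tauE] : exists tau : R, forall t, eval_at (phi t x) tau = t.
  pose e := (size (c i0)).-2.
  have eS : size (c i0) = e.+2 by rewrite /e; case: (size _) size_c => // -[].
  pose q := (c i0)^`(e).
  have q1 : q`_1 != 0.
    rewrite coef_derivn -mulr_natr mulf_neq0 //.
      by rewrite addn1 -[e.+1]/(e.+2.-1) -eS -lead_coefE lead_coef_eq0 -size_poly_eq0 eS.
    by have /pcharf0P -> := char0; rewrite -lt0n ffact_gt0 addn1.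
  have qE t : q.[t] = q`_0 + q`_1 * t.
    rewrite (horner_coef_wide (n := 2)) ?big_ord_recl ?big_ord0 /= ?expr0 ?expr1.
      by rewrite mulr1 addr0.
    apply/leq_sizeP => j j1; rewrite coef_derivn nth_default ?mul0rn //.
    by rewrite eS -addn2 leq_add2l.
  exists ((iter e (lnd phi) (coordinate X i0) - regular_const X q`_0)
      * regular_const X (q`_1)^-1) => t.
  rewrite rmorphM rmorphB /= -[X in X - _]flowP flow_iter_lnd.
  rewrite /family_at -derivn_map -/(c i0) -/q qE.
  rewrite -[eval_at _ (regular_const X q`_0)]/(q`_0) addrC addKr.
  by rewrite -[eval_at _ (regular_const X _)]/(q`_1)^-1 mulrC mulKf.
have [p pE] := regular_function_is_regular tau.
have pt t : p.@[val (phi t x) 0] = t by rewrite -pE -[LHS]/(eval_at _ _) tauE.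
have px : p.@[val x 0] = 0 by rewrite -[x in LHS](one_param0 phi) pt.
exists (dv p); apply/rowP => i; rewrite !mxE -dvX.
have := vanish ('X_i - (map_poly (@mpolyC n k) (c i)).[p]); rewrite -/(dv _) dvN.
rewrite (derivation_horner _ _ dV).
have evh (q : {poly k}) y : ((map_poly (@mpolyC n k) q).[p]).@[y] = q.[p.@[y]].
  elim/poly_ind: q => [|q a IH]; first by rewrite !raddf0 !horner0 meval0.
  rewrite rmorphD rmorphM /= map_polyX map_polyC !hornerMXaddC.
  by rewrite mevalD mevalM IH mevalC.
rewrite /= evh px horner_coef0 coef_deriv mulr1n coef_map => e.
apply/eqP; rewrite -subr_eq0 [_ * eval_at _ _]mulrC; apply/eqP/e => t.
by rewrite mevalB mevalXU evh pt cE subrr.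
Qed.

End OrbitTangent.

Section OrbitParametrization.
Variables (k : closedFieldType) (n : nat) (X : irr_affine_variety k n).
Local Notation R := (regular_function X).
Hypothesis char0 : [pchar k] =i pred0.
Variables (d : nat) (Phi : 'I_d -> one_param X) (x : X).

Definition apply_along (l : seq 'I_d) (t : 'I_d -> k) : X :=
  foldr (fun j y => Phi j (t j) y) x l.

Definition orbit_point := apply_along (enum 'I_d).

Lemma orbit_point_SAut t : orbit_of (@SAut k n X) x (orbit_point t).
Proof.
rewrite /orbit_point; elim: (enum _) => [|j l [g gS gE]] /=.
  by exists 1%g => //; exact: (proj1 (SAut_subgroup X)).
exists (Phi j (t j) * g)%g; first by apply: SAutM gS; exact: SAut_one_param.
by rewrite -gE.
Qed.

Lemma orbit_point_axis l s :
  orbit_point (fun j => 0 + (j == l)%:R * s) = Phi l s x.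
Proof.
have axis (w : seq 'I_d) : uniq w -> apply_along w (fun j => 0 + (j == l)%:R * s) =
    if l \in w then Phi l s x else x.
  elim: w => //= j w IH /andP[jw /IH ->]; rewrite inE add0r.
  have [e|jl] := eqVneq j l; first by rewrite -e (negPf jw) /= mulr1n mul1r.
  by rewrite mul0r one_param0.
by rewrite /orbit_point axis ?enum_uniq // mem_enum.
Qed.

Lemma orbit_point_regular (f : R) : exists Q : {mpoly k[d]},
  forall t, Q.@[t] = eval_at (orbit_point t) f.
Proof.
rewrite /orbit_point; elim: (enum _) f => [|j l IH] f /=.
  by exists (eval_at x f)%:MP => t; rewrite mevalC.
have /choice[Q QE] i := IH (flow (Phi j) f)`_i.
exists (\sum_(i < size (flow (Phi j) f)) 'X_j ^+ i * Q i) => t.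
rewrite -flowP /family_at (horner_coef_wide _ (size_poly _ _)) raddf_sum /=.
apply: eq_bigr => i _; rewrite mevalM rmorphXn /= mevalXU QE coef_map mulrC.
by [].
Qed.

Definition orbit_pullback (f : R) := projT1 (cid (orbit_point_regular f)).

Lemma orbit_pullbackE f t : (orbit_pullback f).@[t] = eval_at (orbit_point t) f.
Proof. by rewrite /orbit_pullback; case: cid. Qed.

(** On the l-th axis only the l-th subgroup moves x. *)
Lemma mderiv_orbit_pullback f l :
  ((orbit_pullback f)^`M(l)).@[fun=> 0] = eval_at x (lnd (Phi l) f).
Proof.
rewrite -mderiv_line /lnd -coef_map.
suff -> : mmap (@polyC k) (line (fun=> 0) l) (orbit_pullback f) =
    map_poly (eval_at x) (flow (Phi l) f) by [].
apply: poly_ext_char0 => // s; rewrite horner_line orbit_pullbackE.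
by rewrite orbit_point_axis -flowP.
Qed.

Hypothesis dimX : variety_dim X d.
Hypothesis freeV : free_rows (fun j i => velocity (Phi j) x 0 i).

(** Let g vanish on the image, and let P(y, g) = 0 be a relation of minimal
    degree between g and d coordinates y with invertible Jacobian at x.  Pulling
    it back to affine space leaves P(y, 0) = 0, so P is divisible by its last
    variable since the pullbacks of y are independent.  If g were nonzero, the
    quotient would be a smaller relation. *)
Lemma orbit_dominant (g : R) :
  (forall t, eval_at (orbit_point t) g = 0) -> g = 0.
Proof.
move=> gO; apply/eqP/negPn/negP => g0.
have [f detf] := free_rows_minor freeV.
pose C j := orbit_pullback (coordinate X (f j)).
have detC : \det (\matrix_(i, j) (C j)^`M(i)) != 0.
  apply: contra_neq detf => /(congr1 (meval (fun=> 0))).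
  rewrite -det_map_mx meval0 => e; rewrite -[RHS]e; congr (\det _); apply/matrixP => i j.
  by rewrite !mxE /C /= mderiv_orbit_pullback.
pose u := extend_fun (fun j => coordinate X (f j)) g.
have [P [P0 Pu minP]] : exists P : {mpoly k[d.+1]}, [/\ P != 0,
    mmap (regular_const X) u P = 0 & forall Q, mmap (regular_const X) u Q = 0 ->
      (msize Q < msize P)%N -> Q = 0].
  apply: minimal_relation; have [_ /(_ (fun j => (u j)%:F)) dep] := dimX.
  apply: contrapT => nP; apply: dep => P; rewrite mmap_tofrac => /eqP.
  rewrite tofrac_eq0 => /eqP Pu; apply/eqP/negPn/negP => P0; apply: nP.
  by exists P.
have [Q PQ] := drop_last_div P.
have dlP : drop_last P = 0.
  have derM i : derivation_along (@mpolyC d k) idfun (@mderiv d k i).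
    split=> [c|p q|p q]; [exact: mderivC|exact: mderivD|exact: mderivM].
  apply: (jacobian_independent (S := predC1 ord_max) (u := extend_fun C 0)
    char0 derM) => [a aS aE j|j|].
  - apply: (minor_extend detC _ aE); apply: aS; by rewrite !inE eqxx.
  - by rewrite !inE negbK => /eqP ->; exact: mderiv_drop_last.
  apply: mpoly_eq0_char0 => // t.
  have -> (Q' : {mpoly k[d.+1]}) :
      (mmap (@mpolyC d k) (extend_fun C 0) (drop_last Q')).@[t] =
      eval_at (orbit_point t) (mmap (regular_const X) u Q').
    rewrite eval_at_mmap /drop_last.
    elim/mpoly_ring_ind: Q' => [c|i|p q hp hq|p q hp hq].
    - by rewrite !mmapC !mevalC.
    - rewrite mmapX mmap1U mevalXU /u; case: (unliftP ord_max i) => [j|] ->.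
        by rewrite !extend_fun_lift mmapX mmap1U extend_fun_lift orbit_pullbackE.
      by rewrite !extend_fun_max rmorph0 meval0 gO.
    - by rewrite !rmorphD /= hp hq.
    - by rewrite !rmorphM /= hp hq.
  by rewrite Pu rmorph0.
move: PQ; rewrite dlP add0r => PQ.
have Q0 : Q != 0 by apply: contra_neq P0 => Q0; rewrite PQ Q0 mulr0.
have X0 : 'X_ord_max != 0 :> {mpoly k[d.+1]}.
  by rewrite -msize_poly_eq0 msizeX.
case/eqP: (Q0); apply: minP.
  move: Pu; rewrite PQ rmorphM /= mmapX mmap1U /u extend_fun_max => /eqP.
  by rewrite mulf_eq0 (negPf g0) => /eqP.
by rewrite PQ msizeM // msizeX mdeg1.
Qed.

End OrbitParametrization.

(** * Images of dominant maps and the equivalence *)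

Section Chevalley.
Variables (k : closedFieldType) (n : nat) (X : irr_affine_variety k n).
Local Notation R := (regular_function X).

Definition point_env (y : X) : seq k := [seq val y 0 i | i <- enum 'I_n].

Lemma nth_point_env y (i : 'I_n) : (point_env y)`_i = val y 0 i.
Proof. by rewrite (nth_map i) ?size_enum_ord // nth_ord_enum. Qed.

Lemma mpoly_term d m (p : {mpoly k[d]}) : exists2 t : GRing.term k,
  GRing.rterm t & forall e, GRing.eval e t = p.@[fun j => e`_(m + j)].
Proof.
elim/mpoly_ring_ind: p => [c|i|p q [s rs sE] [t rt tE]|p q [s rs sE] [t rt tE]].
- by exists (GRing.Const c) => // e; rewrite mevalC.
- by exists (GRing.Var _ (m + i)) => // e; rewrite mevalXU.
- by exists (GRing.Add s t) => [|e] /=; rewrite ?rs // sE tE mevalD.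
- by exists (GRing.Mul s t) => [|e] /=; rewrite ?rs // sE tE mevalM.
Qed.

Lemma rterm_regular (t : GRing.term k) : GRing.rterm t ->
  exists f : R, forall y, GRing.eval (point_env y) t = eval_at y f.
Proof.
elim: t => //= [i|c|m|s IHs t IHt|t IH|t IH m|s IHs t IHt|t IH m].
- move=> _; case: (ltnP i n) => [lin|nli].
    exists (coordinate X (Ordinal lin)) => y.
    by rewrite eval_at_coordinate -nth_point_env.
  by exists 0 => y; rewrite rmorph0 nth_default // size_map size_enum_ord.
- by move=> _; exists (regular_const X c).
- by move=> _; exists m%:R => y; rewrite rmorph_nat.
- by case/andP => /IHs[f fE] /IHt[g gE]; exists (f + g) => y; rewrite rmorphD fE gE.
- by move=> /IH[f fE]; exists (- f) => y; rewrite rmorphN fE.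
- by move=> /IH[f fE]; exists (f *+ m) => y; rewrite rmorphMn fE.
- by case/andP => /IHs[f fE] /IHt[g gE]; exists (f * g) => y; rewrite rmorphM fE gE.
- by move=> /IH[f fE]; exists (f ^+ m) => y; rewrite rmorphXn fE.
Qed.

(** Two nonempty open subsets of an irreducible variety meet, so a condition
    that is generically constant stays so under Boolean operations; an equation
    either holds everywhere or fails on an open set. *)
Lemma qf_generically_constant (f : GRing.formula k) :
  GRing.qf_form f -> GRing.rformula f ->
  exists b, exists2 q : R, q != 0 &
    forall y, eval_at y q != 0 -> GRing.qf_eval (point_env y) f = b.
Proof.
have two f1 f2 (op : bool -> bool -> bool) :
    (exists b, exists2 q : R, q != 0 &
       forall y, eval_at y q != 0 -> GRing.qf_eval (point_env y) f1 = b) ->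
    (exists b, exists2 q : R, q != 0 &
       forall y, eval_at y q != 0 -> GRing.qf_eval (point_env y) f2 = b) ->
    exists b, exists2 q : R, q != 0 & forall y, eval_at y q != 0 ->
       op (GRing.qf_eval (point_env y) f1) (GRing.qf_eval (point_env y) f2) = b.
  move=> [b1 [q1 q10 h1]] [b2 [q2 q20 h2]]; exists (op b1 b2), (q1 * q2).
    exact: mulf_neq0.
  by move=> y; rewrite rmorphM mulf_eq0 negb_or => /andP[/h1 -> /h2 ->].
elim: f => //= [b _ _|s t _ /andP[rs rt]|f1 IH1 f2 IH2|f1 IH1 f2 IH2
  |f1 IH1 f2 IH2|f IH].
- by exists b, 1 => //; exact: oner_neq0.
- have [f fE] := rterm_regular rs; have [g gE] := rterm_regular rt.
  have [fg|fg] := eqVneq f g.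
    by exists true, 1 => [|y _]; rewrite ?oner_neq0 // fE gE fg eqxx.
  exists false, (f - g) => [|y]; first by rewrite subr_eq0.
  by rewrite rmorphB subr_eq0 fE gE => /negPf.
- by move=> /andP[/IH1{}IH1 /IH2{}IH2] /andP[/IH1 h1 /IH2 h2]; exact: (two f1 f2 andb).
- by move=> /andP[/IH1{}IH1 /IH2{}IH2] /andP[/IH1 h1 /IH2 h2]; exact: (two f1 f2 orb).
- by move=> /andP[/IH1{}IH1 /IH2{}IH2] /andP[/IH1 h1 /IH2 h2]; exact: (two f1 f2 implb).
- by move=> /IH{}IH /IH[b [q q0 h]]; exists (~~ b), q => // y /h ->.
Qed.

(** The image is defined by a first-order formula, hence by a quantifier-free
    one.  Its generic truth value cannot be false, because the image would then
    lie in the zero locus of q. *)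
Lemma dominant_image_open d (C : 'I_n -> {mpoly k[d]}) (pt : ('I_d -> k) -> X) :
  (forall t i, val (pt t) 0 i = (C i).@[t]) ->
  (forall g : R, (forall t, eval_at (pt t) g = 0) -> g = 0) ->
  exists2 q : R, q != 0 & forall y, eval_at y q != 0 -> exists t, y = pt t.
Proof.
move=> CE dom.
have /choice[T /all_and2[rT TE]] : forall i, exists t : GRing.term k, GRing.rterm t /\
    forall e, GRing.eval e t = (C i).@[fun j => e`_(n + j)].
  by move=> i; have [t rt tE] := mpoly_term n (C i); exists t.
pose body := foldr (fun (i : 'I_n) f =>
  GRing.And (GRing.Equal (GRing.Var _ i) (T i)) f) (GRing.Bool true) (enum 'I_n).
(* variables 0 .. n-1 stand for the point of X, and n .. n+d-1 for t *)
pose F := foldr (@GRing.Exists k) body (iota n d).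
have rF : GRing.rformula F.
  rewrite /F; elim: (iota n d) => //= ; rewrite /body.
  by elim: (enum 'I_n) => //= i l ->; rewrite rT.
have bodyP e : GRing.holds e body <->
    forall i : 'I_n, e`_i = (C i).@[fun j => e`_(n + j)].
  rewrite /body; have : forall i, i \in enum 'I_n by move=> i; rewrite mem_enum.
  have -> : GRing.holds e (foldr (fun (i : 'I_n) f =>
      GRing.And (GRing.Equal (GRing.Var _ i) (T i)) f) (GRing.Bool true) (enum 'I_n))
    <-> forall i, i \in enum 'I_n -> e`_i = (C i).@[fun j => e`_(n + j)].
    elim: (enum 'I_n) => //= i l ->; rewrite TE; split=> [[h1 h2] j|h].
      by rewrite inE => /predU1P[->|/h2].
    by split=> [|j jl]; apply: h; rewrite inE ?eqxx ?jl ?orbT.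
  by move=> all; split=> h i; [exact: h|move=> _; exact: h].
have FP y : GRing.holds (point_env y) F <-> exists t, y = pt t.
  rewrite /F; split.
    move/GRing.foldExistsP => [e eE /bodyP eB]; exists (fun j => e`_(n + j)).
    apply/val_inj/rowP => i; rewrite CE -eB -nth_point_env; apply: eE.
    by rewrite inE mem_iota leqNgt ltn_ord.
  move=> [t ->]; apply/GRing.foldExistsP.
  exists (point_env (pt t) ++ [seq t j | j <- enum 'I_d]).
    move=> i; rewrite inE mem_iota negb_and -ltnNge -leqNgt.
    rewrite nth_cat size_map size_enum_ord.
    case/orP => [->//|ndi]; have ni := leq_trans (leq_addr d n) ndi.
    rewrite (ltnNge i n) ni /= !nth_default //.
      by rewrite size_map size_enum_ord leq_subRL.
    by rewrite size_map size_enum_ord.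
  apply/bodyP => i; rewrite nth_cat size_map size_enum_ord ltn_ord nth_point_env CE.
  apply: meval_eq => j; rewrite nth_cat size_map size_enum_ord ltnNge leq_addr /=.
  by rewrite addKn (nth_map j) ?size_enum_ord // nth_ord_enum.
pose proj := @ClosedFieldQE.ex_elim k.
have proj_wf : GRing.wf_QE_proj proj := @ClosedFieldQE.wf_ex_elim k.
have proj_ok : GRing.valid_QE_proj proj :=
  ClosedFieldQE.holds_ex_elim (@solve_monicpoly k).
have /andP[qfF rqF] := GRing.quantifier_elim_wf proj_wf rF.
have [b [q q0 qb]] := qf_generically_constant qfF rqF; exists q => // y qy.
apply/FP/(GRing.quantifier_elim_rformP proj_wf proj_ok _ rF); rewrite qb //.
apply/negPn/negP => bF; case/eqP: (q0); apply: dom => t.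
apply/eqP/negPn/negP => qt; case/negP: bF; rewrite -(qb (pt t) qt).
by apply/(GRing.quantifier_elim_rformP proj_wf proj_ok _ rF)/FP; exists t.
Qed.

End Chevalley.

Section FlexiblePoint.
Variables (k : closedFieldType) (n : nat) (X : irr_affine_variety k n).
Local Notation R := (regular_function X).
Hypothesis char0 : [pchar k] =i pred0.

(** The tangent space is spanned by the tangent lines of orbits, hence by
    velocities; a maximal free sequence of velocities is a basis of it. *)
Lemma flexible_velocities (x : X) : flexible_point x ->
  exists (d : nat) (Phi : 'I_d -> one_param X),
    variety_dim X d /\ free_rows (fun j i => velocity (Phi j) x 0 i).
Proof.
move=> [[d dimX [U [TU dimU]]] Tspan].
pose vs (s : seq (one_param X)) := [seq velocity phi x | phi <- s].
pose P m := `[< exists2 s : seq (one_param X), size s = m & free (vs s) >].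
have exP : exists m, P m.
  by exists 0%N; apply/asboolP; exists [::] => //; exact: nil_free.
have leP m : P m -> (m <= n)%N.
  move=> /asboolP[s <-]; rewrite -(size_map (fun phi => velocity phi x)) /free => /eqP <-.
  by rewrite (leq_trans (dimvS (subvf _))) // dimvf dim_matrix mul1r.
case: (ex_maxnP exP leP) => m /asboolP[s sm free_s] maxm.
have span_s phi : velocity phi x \in <<vs s>>%VS.
  apply/negPn/negP => ns; suff /maxm : P m.+1 by rewrite ltnn.
  by apply/asboolP; exists (phi :: s); rewrite /= ?sm // free_cons ns.
have UE : U = <<vs s>>%VS.
  apply/eqP; rewrite eqEsubv; apply/andP; split.
    apply/subvP => v vU.
    have : tangent_space X (val x) v by rewrite TU.
    rewrite Tspan => -[w wT]; apply/subvP; apply/span_subvP => z /wT[H].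
    move=> /one_paramP[phi ->] /(orbit_tangent_line char0)[c ->].
    exact: memvZ.
  apply/span_subvP => _ /mapP[phi _ ->].
  suff : tangent_space X (val x) (velocity phi x) by rewrite TU.
  have := @velocity_tangent _ _ _ char0 phi x.
  by apply: tangent_space_sub; exact: orbit_sub.
have dE : d = size s by rewrite -dimU UE (eqP free_s) size_map.
exists (size s), (fun j => tnth (in_tuple s) j); split; first by rewrite -dE.
move=> b bV.
apply: (freeP (X := map_tuple (fun phi => velocity phi x) (in_tuple s)) free_s b).
apply/rowP => i; rewrite summxE mxE -[RHS](bV i); apply: eq_bigr => j _.
by rewrite -tnth_nth tnth_map mxE.
Qed.

Lemma flexible_parametrization (x : X) : flexible_point x ->
  exists d (C : 'I_n -> {mpoly k[d]}) (pt : ('I_d -> k) -> X),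
  [/\ forall t i, val (pt t) 0 i = (C i).@[t],
      forall t, orbit_of (@SAut k n X) x (pt t)
    & forall g : R, (forall t, eval_at (pt t) g = 0) -> g = 0].
Proof.
move=> /flexible_velocities[d [Phi [dimX freeV]]].
exists d, (fun i => orbit_pullback Phi x (coordinate X i)), (orbit_point Phi x).
split=> [t i|t|g].
- by rewrite orbit_pullbackE eval_at_coordinate.
- exact: orbit_point_SAut.
- exact: orbit_dominant.
Qed.

(** The orbit contains a nonempty principal open set, and it is the union of the
    translates of this set. *)
Theorem flexible_open_orbit (x : X) : flexible_point x ->
  zariski_open (orbit_of (@SAut k n X) x).
Proof.
move=> /flexible_parametrization[d [C [pt [CE ptO dom]]]].
have [q q0 qpt] := dominant_image_open CE dom.
(* the polynomials representing the translates of q by the group *)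
pose S : set {mpoly k[n]} := [set p : {mpoly k[n]} | exists2 g : automorphism X,
  SAut g & forall y : X, p.@[val y 0] = eval_at (g y) q]%classic.
exists (zero_locus S); first by exists S.
have orbit_q y : eval_at y q != 0 -> orbit_of (@SAut k n X) x y.
  by move=> /qpt[t ->].
apply/seteqP; split=> y /=; last first.
  move=> ny; have [p [g gS pE] py] : exists2 p, S p & p.@[val y 0] != 0.
    apply: contrapT => np; apply: ny => p Sp; apply/eqP/negPn/negP => py.
    by apply: np; exists p.
  rewrite pE in py; have [h hS hx] := orbit_q _ py.
  exists (g^-1 * h)%g; first by apply: SAutM => //; exact: SAutV.
  by rewrite /= hx aut_funK.
move=> [g gS gx] ySZ; have [z qz] := neq0_point q0.
have [h hS hx] := orbit_q _ qz.
have [p pE] := regular_function_is_regular (pullback (h * g^-1)%g q).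
case/eqP: qz; rewrite -(ySZ p).
  by rewrite -pE -[RHS]/(eval_at ((h * g^-1)%g y) q) -gx /= aut_funK hx.
exists (h * g^-1)%g; first by apply: SAutM => //; exact: SAutV.
by move=> w; rewrite -pE.
Qed.

Theorem flexible_unirational (x : X) : flexible_point x -> unirational X.
Proof.
move=> /flexible_parametrization[d [C [pt [CE _ dom]]]].
exists d, 1, C; split; first exact: oner_neq0.
  move=> _ [a _ <-]; suff -> : \row_i ((C i).@[a 0] / 1.@[a 0]) = val (pt (a 0)).
    exact/set_mem/valP.
  by apply/rowP => i; rewrite mxE meval1 divr1 CE.
move=> y yX p pI; have p0 : regular_of_mpoly X p = 0.
  apply: dom => t; pose a : 'rV[k]_d := \row_j t j.
  have aE : a 0 =1 t by move=> j; rewrite mxE.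
  rewrite -[LHS]/(p.@[_]) -(pI (val (pt t))) //; exists a.
    by rewrite /= meval1 oner_neq0.
  apply/rowP => i; rewrite mxE meval1 divr1 CE; exact: meval_eq.
by rewrite -[LHS]/(eval_at (SigSub (mem_set yX)) (regular_of_mpoly X p)) p0.
Qed.

End FlexiblePoint.

Theorem proposition5p1 (k : closedFieldType) (n : nat)
    (X : irr_affine_variety k n) (char0 : [pchar k]%R =i pred0) :
  [/\ (exists x : X, flexible_point x)
        <-> (exists x : X, zariski_open (orbit_of (@SAut k n X) x)),
      (exists x : X, zariski_open (orbit_of (@SAut k n X) x))
        <-> FML_trivial X
    & FML_trivial X -> unirational X].
Proof.
have openFML (h : exists x : X, zariski_open (orbit_of (@SAut k n X) x)) :
    FML_trivial X by case: h => x; exact: open_orbit_FML.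
have flexopen (h : exists x : X, flexible_point x) :
    exists x : X, zariski_open (orbit_of (@SAut k n X) x).
  by case: h => x /(flexible_open_orbit char0); exists x.
split; first by split=> [/flexopen|/openFML/(FML_flexible char0)].
  by split=> [/openFML|/(FML_flexible char0)/flexopen].
by move=> /(FML_flexible char0)[x]; exact: flexible_unirational.
Qed.
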